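(* Suppose that $\alpha_1,\dots,\alpha_{k_0}\in\mathbb{D}$ and $\eta_1,\dots,\eta_{k_1}\in\mathbb{T}$, where $2k_0+k_1=n$, and suppose that $\beta_1,\dots,\beta_m\in\mathbb{D}$. Suppose that $\sigma_1,\dots,\sigma_n$ in $\overline{\mathbb{D}}$ are distinct from $\eta_1,\dots,\eta_{k_1}$. Then there exists a rational $\overline{\mathcal{P}}$-inner function $x=(a,s,p)$ of degree less than or equal to $(m+n,n)$ such that (1) the zeros of $a$ in $\mathbb{D}$, repeated according to multiplicity, are $\beta_1,\dots,\beta_m$; (2) the zeros of $s$ in $\overline{\mathbb{D}}$, repeated according to multiplicity, are $\alpha_1,\dots,\alpha_{k_0}$ and $\eta_1,\dots,\eta_{k_1}$; (3) the royal nodes of $(s,p)$ are $\sigma_1,\dots,\sigma_n$. Such a function $x$ can be constructed as follows. Let $t_+>0$ and let $t\in\mathbb{R}\setminus\{0\}$. Let $R$ and $E$ be defined by $$R(\lambda)=t_+\prod_{j=1}^n(\lambda-\sigma_j)(1-\overline{\sigma_j}\lambda),$$ $$E(\lambda)=t\prod_{j=1}^{k_0}(\lambda-\alpha_j)(1-\overline{\alpha_j}\lambda)\prod_{j=1}^{k_1}ie^{-i\theta_j/2}(\lambda-\eta_j),$$ where $\eta_j=e^{i\theta_j}$, $0\le\theta_j<2\pi$. Let $a_{in}:\mathbb{D}\to\overline{\mathbb{D}}$ be defined by $a_{in}(\lambda)=c\prod_{i=1}^mB_{\beta_i}(\lambda)$, where $|c|=1$. Then: (i) There exist outer polynomials $D$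 and $A$ of degree at most $n$ such that $$\lambda^{-n}R(\lambda)+|E(\lambda)|^2=4|D(\lambda)|^2\quad\text{and}\quad\lambda^{-n}R(\lambda)=4|A(\lambda)|^2$$ for all $\lambda\in\mathbb{T}$. (ii) The function $x$ defined by $$x=(a,s,p)=\Big(a_{in}\frac{A}{D},\frac{E}{D},\frac{D^{\sim n}}{D}\Big)$$ is a rational $\overline{\mathcal{P}}$-inner function such that $\deg(x)\le(m+n,n)$ and conditions (1), (2) and (3) hold. The royal polynomial of $(s,p)$ is $R$, that is, $R=4DD^{\sim n}-E^2$.
   Context: $\mathbb{D}$ is the open unit disc in $\mathbb{C}$, $\mathbb{T}$ the unit circle. $\mathbb{B}^{2\times2}$ is the open unit ball of the complex $2\times2$ matrices in the operator norm. The pentablock is $\mathcal{P}=\{(a_{21},\operatorname{tr}A,\det A): A=[a_{ij}]_{i,j=1}^2\in\mathbb{B}^{2\times2}\}\subset\mathbb{C}^3$, with closure $\overline{\mathcal{P}}$ and distinguished boundary $$b\overline{\mathcal{P}}=\Big\{(a,s,p)\in\mathbb{C}^3: |s|\le2,\ |p|=1,\ s=\overline{s}p,\ |a|=\sqrt{1-\tfrac14|s|^2}\Big\}.$$ A rational $\overline{\mathcal{P}}$-inner function is a rational analytic map $x:\mathbb{D}\to\overline{\mathcal{P}}$ (which extends continuously to $\overline{\mathbb{D}}$) that maps $\mathbb{T}$ into $b\overline{\mathcal{P}}$. Its degree is the pair $(\deg a,\deg p)$ of degrees of the rational functions $a$ and $p$; degree $\le(m,n)$ means $\deg a\le m$ and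 $\deg p\le n$. The royal nodes of $(s,p)$ are the points $\lambda\in\overline{\mathbb{D}}$ with $s(\lambda)^2=4p(\lambda)$. When $s=E/D$, $p=D^{\sim n}/D$ with $D$ nonvanishing on $\overline{\mathbb{D}}$, the royal polynomial of $(s,p)$ is $4D(\lambda)D^{\sim n}(\lambda)-E(\lambda)^2$. For a polynomial $g$ of degree at most $n$, $g^{\sim n}(\lambda)=\lambda^n\overline{g(1/\overline{\lambda})}$. A polynomial is outer if it has no zeros in $\mathbb{D}$. For $\alpha\in\mathbb{D}$, $B_\alpha(z)=\dfrac{z-\alpha}{1-\overline{\alpha}z}$. *)

(* Defs.v *)
From HB Require Import structures.
From mathcomp Require Import all_boot all_order all_algebra.
From mathcomp Require Import generic_quotient fraction polydiv complex.
From mathcomp Require Import all_classical all_reals all_analysis.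

Set Implicit Arguments.
Unset Strict Implicit.
Unset Printing Implicit Defensive.

Import Order.TTheory GRing.Theory Num.Theory.
Import numFieldNormedType.Exports.

Local Open Scope classical_set_scope.
Local Open Scope ring_scope.

(* The library has the norm topology and the normed space structure of a
   [numFieldType] K on [K^o]; they are transferred here to R[i], seen as a
   normed space over itself. *)
#[warnings="-redundant-canonical-projection"]
HB.instance Definition _ (R : realType) := NormedModule.copy R[i] R[i]^o.

Section Definitions.
Variable R : realType.
Local Notation C := R[i].

Definition open_disc : set C := [set z | `|z| < 1].
Definition closed_disc : set C := [set z | `|z| <= 1].
Definition circle : set C := [set z | `|z| = 1].

Definition cis (theta : R) : C := (cos theta +i* sin theta)%C.

Definition l2norm n (v : 'cV[C]_n) : R :=
  Num.sqrt (\sum_i ComplexField.Normc.normc (v i 0) ^+ 2).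

Definition opnorm n (A : 'M[C]_n) : R :=
  sup [set l2norm (A *m v) | v in [set v : 'cV[C]_n | l2norm v <= 1]].

(* Row and column indices start at 0: [A 1 0] is the entry a_21. *)
Definition pentablock : set (C * C * C) :=
  [set x | exists2 A : 'M[C]_2, opnorm A < 1 & x = (A 1 0, \tr A, \det A)].

(* [sqrtC] is the nonnegative square root when its argument is nonnegative. *)
Definition dist_bdry_pentablock : set (C * C * C) :=
  [set x | let: (a, s, p) := x in
    [/\ `|s| <= 2, `|p| = 1, s = s^* * p
      & `|a| = sqrtC (1 - 4^-1 * `|s| ^+ 2)]].

(* A rational function is an element of the field C(z). It is given a
   numerator and a denominator in lowest terms (up to a common nonzero
   constant), from which its degree, its values and the multiplicities of its
   zeros are read off. At a pole [rat_eval] takes the junk value 0. *)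
Definition ratfun := {fraction {poly C}}.

Definition rnum (f : ratfun) : {poly C} :=
  (repr f).1 %/ gcdp (repr f).1 (repr f).2.
Definition rden (f : ratfun) : {poly C} :=
  (repr f).2 %/ gcdp (repr f).1 (repr f).2.

Definition rat_deg (f : ratfun) : nat :=
  (maxn (size (rnum f)) (size (rden f))).-1.

Definition rat_eval (f : ratfun) (z : C) : C := (rnum f).[z] / (rden f).[z].

(* The zeros of f in S, repeated according to multiplicity, are the entries of
   zs (in some order). *)
Definition zeros_are (S : set C) (f : ratfun) (zs : seq C) : Prop :=
  f != 0 /\
  forall z, count_mem z zs = if z \in S then mup z (rnum f) else 0%N.

Definition ratmap := (ratfun * ratfun * ratfun)%type.

Definition ratmap_eval (x : ratmap) (z : C) : C * C * C :=
  let: (a, s, p) := x in (rat_eval a z, rat_eval s z, rat_eval p z).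

(* Derivability along 1 over the field C is complex differentiability; it
   fails at the poles in spite of the junk value. *)
Definition analytic_on (S : set C) (f : ratfun) : Prop :=
  forall z, S z -> derivable (rat_eval f : C -> C) z 1.

Definition rational_pentablock_inner (x : ratmap) : Prop :=
  let: (a, s, p) := x in
  [/\ [/\ analytic_on open_disc a, analytic_on open_disc s
        & analytic_on open_disc p],
      {within closed_disc, continuous (ratmap_eval x)},
      forall z, open_disc z -> closure pentablock (ratmap_eval x z)
    & forall z, circle z -> dist_bdry_pentablock (ratmap_eval x z)].

Definition pdeg_le (x : ratmap) (m n : nat) : Prop :=
  let: (a, s, p) := x in (rat_deg a <= m)%N /\ (rat_deg p <= n)%N.

Definition royal_nodes (s p : ratfun) : set C :=
  [set z | closed_disc z /\ rat_eval s z ^+ 2 = 4 * rat_eval p z].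

(* g^{~n}, as a polynomial; see [conj_revE]. *)
Definition conj_rev (n : nat) (g : {poly C}) : {poly C} :=
  \poly_(i < n.+1) (g`_(n - i))^*.

Definition royal_poly (n : nat) (D E : {poly C}) : {poly C} :=
  4 *: (D * conj_rev n D) - E ^+ 2.

Definition outer (g : {poly C}) : Prop := forall z, open_disc z -> g.[z] != 0.

Definition blaschke (b : C) : ratfun :=
  tofrac ('X - b%:P) / tofrac (1 - b^* *: 'X).

Definition blaschke_prod (c : C) (bs : seq C) : ratfun :=
  tofrac c%:P * \prod_(b <- bs) blaschke b.

Definition Rpoly (tp : R) (sigma : seq C) : {poly C} :=
  tp%:C%C *: \prod_(z <- sigma) (('X - z%:P) * (1 - z^* *: 'X)).

Definition Epoly (t : R) (alpha : seq C) (theta : seq R) : {poly C} :=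
  t%:C%C *: (\prod_(z <- alpha) (('X - z%:P) * (1 - z^* *: 'X))
          * \prod_(th <- theta) (('i%C * cis (- th / 2)) *: ('X - (cis th)%:P))).

End Definitions.

Lemma conj_revE (R : realType) (n : nat) (g : {poly R[i]}) (z : R[i]) :
  (size g <= n.+1)%N -> z != 0 ->
  (conj_rev n g).[z] = z ^+ n * (g.[(z^*)^-1])^*.
Proof.
move=> sg z0; rewrite horner_poly (horner_coef_wide _ sg) rmorph_sum mulr_sumr.
rewrite (reindex_inj rev_ord_inj) /=; apply: eq_bigr => i _.
have ile : (i <= n)%N by rewrite -ltnS.
rewrite subSS subKn// rmorphM/= mulrCA; congr (_ * _).
rewrite rmorphXn/= fmorphV/= conjCK exprVn.
have -> : z ^+ n = z ^+ (n - i) * z ^+ i by rewrite -exprD subnK.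
by rewrite mulfK// expf_neq0.
Qed.

Lemma frac_repr (T : idomainType) (f : {fraction T}) :
  f * tofrac (repr f).2 = tofrac (repr f).1.
Proof.
rewrite -{1}[f]reprK; unlock FracField.tofrac; rewrite -[LHS]FracField.pi_mul.
apply/eqmodP; rewrite /= FracField.equivfE /FracField.mulf /=.
by rewrite !numden_Ratio ?mulf_neq0 ?oner_neq0 ?denom_ratioP// !mulr1 mulrC.
Qed.

Lemma rnum_rdenE (R : realType) (N Q : {poly R[i]}) :
  Q != 0 -> rnum (tofrac N / tofrac Q) * Q = N * rden (tofrac N / tofrac Q).
Proof.
move=> Q0; set f := _ / _.
have d0 : (repr f).2 != 0 by exact: denom_ratioP.
have g0 : gcdp (repr f).1 (repr f).2 != 0 by rewrite gcdp_eq0 negb_and d0 orbT.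
have H : (repr f).1 * Q = N * (repr f).2.
  apply/eqP; rewrite -tofrac_eq !rmorphM/= -frac_repr.
  by rewrite mulrAC /f divfK// tofrac_eq0.
apply: (mulIf g0); rewrite /rnum /rden mulrAC divpK ?dvdp_gcdl//.
by rewrite -[RHS]mulrA divpK ?dvdp_gcdr.
Qed.

Lemma rat_evalE (R : realType) (N Q : {poly R[i]}) (z : R[i]) :
  Q.[z] != 0 -> rat_eval (tofrac N / tofrac Q) z = N.[z] / Q.[z].
Proof.
move=> Qz; have Q0 : Q != 0 by apply: contraNneq Qz => ->; rewrite horner0.
set f := _ / _; have /(congr1 (horner^~ z)) := rnum_rdenE N Q0.
rewrite -/f !hornerM => e.
have dz : (rden f).[z] != 0.
  apply/eqP => dz; move: e; rewrite dz mulr0 => /eqP.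
  rewrite mulf_eq0 (negbTE Qz) orbF => /eqP nz.
  have cop : coprimep (rnum f) (rden f).
    by apply: coprimep_div_gcd; apply/orP; right; exact: denom_ratioP.
  have nr : root (rnum f) z by apply/eqP.
  by have := coprimep_root cop nr; rewrite dz eqxx.
by apply/eqP; rewrite /rat_eval eqr_div// e.
Qed.

(* Main.v *)
Require Import Defs.
From mathcomp Require Import all_boot all_order all_algebra.
From mathcomp Require Import generic_quotient fraction polydiv complex.
From mathcomp Require Import all_classical all_reals all_analysis.
From mathcomp Require Import ring lra zify.

Set Implicit Arguments.
Unset Strict Implicit.
Unset Printing Implicit Defensive.

Import Order.TTheory GRing.Theory Num.Theory.
Import numFieldNormedType.Exports.

Local Open Scope classical_set_scope.
Local Open Scope ring_scope.

(** The royal polynomial R and the polynomial E are both reciprocal: on the unit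
circle z^-n R(z) is nonnegative and E(z) = z^n conj (E(z)).  The sum
z^-n R + |E|^2 is even positive there, because a common zero on the circle would
be a royal node equal to some eta_j.  So the Fejer-Riesz theorem
([fejer_riesz]) gives D without zeros in the closed disc, and A can be written
down from the sigma_j.  Two polynomials that agree on the circle are equal, hence
R = 4 A A~ = 4 D D~ - E^2 with g~ = conj_rev n g, which already settles the royal
nodes.

The map takes its values in the closed pentablock because of the matrix function
F = [[E/2, -A~], [A, E/2]] / D.  It has trace E/D, determinant D~/D and lower
left entry A/D, and on the circle it is unitary.  The maximum principle
([ratio_max_principle]), applied to the scalar functions w^T F v, makes F(z) a
contraction for |z| < 1 ([matrix_contraction]), so that (A/D, E/D, D~/D) lies in
the closure of the pentablock.  Multiplying the first coordinate by the number
zeta = a_in(z) with |zeta| <= 1 is harmless: both diagonal entries of F are equal,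
and a unitary conjugation, which preserves norm, trace and determinant, turns the
corner entry b into zeta b ([rotate_shrinks_corner]).  On the circle the
conditions that define the distinguished boundary are restatements of
4 |A|^2 + |E|^2 = 4 |D|^2 and of the reciprocity of E.

The maximum principle for rational functions is proved by algebra.  A
polynomial bounded by c on the circle has all its coefficients bounded by c
([coef_le_circle]); this gives |p(z)| <= c / (1 - |z|), and the same bound for the
powers of p removes the factor 1 / (1 - |z|) ([poly_max_principle]).  A denominator is
eliminated one linear factor at a time. *)

(** * The maximum principle *)

Section Circle.
Variable R : realType.
Local Notation C := R[i].
Implicit Types (z w c : C) (p q : {poly C}).

Lemma circle_neq0 z : circle z -> z != 0.
Proof. by rewrite -normr_eq0 => ->; rewrite oner_eq0. Qed.

Lemma circle_conj z : circle z -> z^* = z^-1.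
Proof. by move=> z1; rewrite [RHS]invC_norm z1 expr1n invr1 mul1r. Qed.

Lemma unimodular_sqrt z : `|z| = 1 -> `|sqrtC z| = 1.
Proof.
by move=> z1; apply/eqP; rewrite -sqrp_eq1// -normrX sqrtCK; apply/eqP.
Qed.

(** The even part e and the odd part o of p satisfy p(w) = e(w^2) + w o(w^2), so
that 2 e(w^2) = p(w) + p(-w) and 2 w o(w^2) = p(w) - p(-w).  Every z on the circle
is such a w^2, hence e and o obey the bound of p, and they have fewer
coefficients. *)
Lemma coef_le_circle p c :
  (forall z, circle z -> `|p.[z]| <= c) -> forall i, `|p`_i| <= c.
Proof.
have [n] := ubnP (size p); elim: n p => // n IHn p; rewrite ltnS => sp pc.
have [sp1|sp1] := leqP (size p) 1.
  move=> i; rewrite [p]size1_polyC// coefC; case: i => [|i] /=.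
    by have := pc 1 (normr1 _); rewrite [p in p.[1]]size1_polyC// hornerC.
  by rewrite normr0; apply: le_trans (pc 1 (normr1 _)).
have parts z : circle z ->
    `|(even_poly p).[z]| <= c /\ `|(odd_poly p).[z]| <= c.
  move=> z1; have s1 := unimodular_sqrt z1.
  have pE w : p.[w] = (even_poly p).[w ^+ 2] + (odd_poly p).[w ^+ 2] * w.
    by rewrite -{1}[p]poly_even_odd !hornerE !horner_comp !hornerE.
  have := pc _ s1; have := pc (- sqrtC z); rewrite /circle/= normrN => /(_ s1).
  rewrite !pE sqrrN sqrtCK; set e := (even_poly p).[z].
  set o := (odd_poly p).[z] * sqrtC z.
  have oE : `|(odd_poly p).[z]| = `|o| by rewrite /o normrM s1 mulr1.
  rewrite mulrN -/o oE => cN cP; split.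
    rewrite -(@ler_pM2l _ 2)// -[X in X * `|e|]normr_nat -normrM.
    have -> : 2 * e = (e - o) + (e + o) by ring.
    by rewrite (le_trans (ler_normD _ _))// mulr2n mulrDl mul1r lerD.
  rewrite -(@ler_pM2l _ 2)// -[X in X * `|o|]normr_nat -normrM.
  have -> : 2 * o = (e + o) - (e - o) by ring.
  by rewrite (le_trans (ler_normB _ _))// mulr2n mulrDl mul1r lerD.
have Hlt : (uphalf (size p) < size p)%N by lia.
move=> i; rewrite -(odd_double_half i); case: (odd i) => /=.
  rewrite add1n -coef_odd_poly; apply: IHn => [|z /parts[]//].
  by rewrite (leq_ltn_trans (size_odd_poly _))// (leq_trans _ sp)//; lia.
rewrite add0n -coef_even_poly; apply: IHn => [|z /parts[]//].
by rewrite (leq_ltn_trans (size_even_poly _))// (leq_trans Hlt).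
Qed.

Lemma poly_circle0 p : (forall z, circle z -> p.[z] = 0) -> p = 0.
Proof.
move=> p0; apply/polyP => i; rewrite coef0; apply/eqP; rewrite -normr_le0.
by apply: coef_le_circle => z /p0 ->; rewrite normr0.
Qed.

Lemma poly_circle_eq p q : (forall z, circle z -> p.[z] = q.[z]) -> p = q.
Proof.
move=> pq; apply/eqP; rewrite -subr_eq0; apply/eqP/poly_circle0 => z /pq e.
by rewrite !hornerE e subrr.
Qed.

Lemma exists_nat_gt_norm z : exists n : nat, `|z| < n%:R.
Proof.
exists (Num.bound (complex.Re `|z|)).
have zE : `|z| = (complex.Re `|z|)%:C%C by rewrite RRe_real// normr_real.
rewrite [X in X < _]zE -(rmorph_nat (real_complex R)) ltcR.
by apply: archi_boundP; rewrite -ler0c -zE normr_ge0.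
Qed.

Lemma bernoulli (x : C) n : 0 <= x -> 1 + n%:R * x <= (1 + x) ^+ n.
Proof.
move=> x0; elim: n => [|n IH]; first by rewrite mul0r addr0.
rewrite exprS; apply: le_trans (_ : (1 + x) * (1 + n%:R * x) <= _).
  rewrite -subr_ge0 (_ : _ - _ = n%:R * x ^+ 2); last by rewrite -natr1; ring.
  by rewrite mulr_ge0// exprn_ge0.
by rewrite ler_wpM2l// addr_ge0.
Qed.

Lemma exprn_unbounded (x c : C) : 1 < x -> exists n, `|c| < x ^+ n.
Proof.
move=> x1; have e0 : 0 < x - 1 by rewrite subr_gt0.
have [n nP] := exists_nat_gt_norm (c / (x - 1)); exists n.
have -> : x = 1 + (x - 1) by ring.
apply: lt_le_trans (bernoulli n (ltW e0)).
rewrite normrM normfV (gtr0_norm e0) ltr_pdivrMr// in nP.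
by rewrite (lt_trans nP)// ltrDr.
Qed.

(** Summing the coefficient bounds gives the estimate [crude], off by the factor
1 / (1 - |z|).  That factor is the same for p and for all powers of p, so a value
|p(z)| > c would violate the estimate for p ^+ n and c ^+ n, n large. *)
Lemma poly_max_principle p c z : open_disc z ->
  (forall w, circle w -> `|p.[w]| <= c) -> `|p.[z]| <= c.
Proof.
rewrite /open_disc/= => z1 pc.
have c0 : 0 <= c by apply: le_trans (pc 1 (normr1 _)).
have crude q d : (forall w, circle w -> `|q.[w]| <= d) ->
    `|q.[z]| * (1 - `|z|) <= d.
  move=> qd; have d0 : 0 <= d by apply: le_trans (qd 1 (normr1 _)).
  have qz : `|q.[z]| <= d * \sum_(i < size q) `|z| ^+ i.
    rewrite horner_coef (le_trans (ler_norm_sum _ _ _))// mulr_sumr.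
    by apply: ler_sum => i _; rewrite normrM normrX ler_wpM2r// coef_le_circle.
  apply: le_trans (ler_wpM2r _ qz) _; first by rewrite subr_ge0 ltW.
  rewrite -mulrA [_ * (1 - _)]mulrC -opprB mulNr -subrX1 opprB.
  by rewrite ler_piMr// gerBl exprn_ge0.
have z10 : 0 < 1 - `|z| by rewrite subr_gt0.
have [c_eq0|c_neq0] := eqVneq c 0.
  by have := crude _ _ pc; rewrite c_eq0 pmulr_lle0.
have cgt0 : 0 < c by rewrite lt_def c_neq0.
rewrite real_leNgt ?ger0_real//; apply/negP => cp.
have pc1 : 1 < `|p.[z]| / c by rewrite ltr_pdivlMr// mul1r.
have [n nP] := exprn_unbounded (1 - `|z|)^-1 pc1.
have := crude (p ^+ n) (c ^+ n) _; rewrite horner_exp normrX.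
have H w : circle w -> `|(p ^+ n).[w]| <= c ^+ n.
  by move=> /pc ?; rewrite horner_exp normrX lerXn2r ?nnegrE.
move=> /(_ H); apply/negP.
rewrite -real_ltNge ?ger0_real ?exprn_ge0 ?mulr_ge0 ?exprn_ge0// ?ltW//.
rewrite gtr0_norm ?invr_gt0// in nP.
rewrite expr_div_n ltr_pdivlMr ?exprn_gt0// mulrC ltr_pdivrMr// in nP.
Qed.

(** The roots r of Q have modulus greater than 1.  To remove the factor X - r,
multiply N by the sum S such that (X - r) S = X^K - r^K: up to the factor
|w^K - r^K|, which lies between |r|^K - 1 and |r|^K + 1, the polynomial N S
satisfies the hypothesis for Q / (X - r).  As K grows, the ratio of these two
numbers tends to 1. *)
Lemma ratio_max_principle (N Q : {poly C}) c z :
  (forall w, closed_disc w -> Q.[w] != 0) ->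
  (forall w, circle w -> `|N.[w]| <= c * `|Q.[w]|) ->
  open_disc z -> `|N.[z]| <= c * `|Q.[z]|.
Proof.
move=> Q0 NQ z1.
have [rs Qrs] := closed_field_poly_normal Q.
have l0 : lead_coef Q != 0.
  apply: contraTneq (Q0 0 _) => [/eqP|]; last by rewrite /closed_disc/= normr0.
  by rewrite lead_coef_eq0 => /eqP ->; rewrite horner0 eqxx.
have rs1 : all (fun r => 1 < `|r|) rs.
  apply/allP => r rrs; rewrite real_ltNge//; apply/negP => /Q0 /eqP; apply.
  by apply/eqP; rewrite Qrs -rootE rootZ// root_prod_XsubC.
move: NQ; rewrite Qrs !hornerZ normrM; set l := lead_coef Q in l0 *.
move: rs1 c; clear Q0 Qrs => rs1.
suff H c : (forall w, circle w ->
      `|N.[w]| <= c * `|(\prod_(r <- rs) ('X - r%:P)).[w]|) ->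
    `|N.[z]| <= c * `|(\prod_(r <- rs) ('X - r%:P)).[z]|.
  move=> c NQ; rewrite mulrA; apply: H => w /NQ.
  by rewrite hornerZ normrM mulrA.
elim: rs N c rs1 => [|r rs IH] N c /=.
  rewrite big_nil hornerC normr1 mulr1 => _ NQ.
  by apply: poly_max_principle => // w /NQ; rewrite hornerC normr1 mulr1.
case/andP=> r1 rs1; rewrite big_cons; set Q' := \prod_(_ <- _) _ => NQ.
have c0 : 0 <= c.
  have := NQ 1 (normr1 _) => /(le_trans (normr_ge0 _)).
  rewrite pmulr_lge0// normr_gt0 hornerM mulf_neq0//.
    rewrite !hornerE subr_eq0; apply: contraTneq r1 => <-.
    by rewrite normr1 ltxx.
  rewrite -rootE root_prod_XsubC; apply/negP => /(allP rs1).
  by rewrite normr1 ltxx.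
have NS K : `|N.[z]| * (`|r| ^+ K - 1) <=
    (c * `|('X - r%:P).[z] * Q'.[z]|) * (`|r| ^+ K + 1).
  pose S := \sum_(i < K) 'X^(K.-1 - i) * r%:P ^+ i.
  have SE w : ('X - r%:P).[w] * S.[w] = w ^+ K - r ^+ K.
    by rewrite -hornerM -subrXX !hornerE.
  have := IH (N * S) (c * (`|r| ^+ K + 1)) rs1 _.
  have H w : circle w -> `|(N * S).[w]| <= c * (`|r| ^+ K + 1) * `|Q'.[w]|.
    move=> w1; rewrite hornerM normrM.
    apply: le_trans (_ : c * `|(('X - r%:P) * Q').[w]| * `|S.[w]| <= _).
      by rewrite ler_wpM2r// NQ.
    rewrite hornerM [`|_ * _|]normrM -!mulrA ler_wpM2l//.
    rewrite [_ * `|S.[w]|]mulrC mulrA.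
    rewrite ler_wpM2r// -normrM SE.
    by rewrite (le_trans (ler_normB _ _))// !normrX w1 expr1n addrC.
  move=> /(_ H) {}H.
  apply: le_trans (_ : `|N.[z]| * `|z ^+ K - r ^+ K| <= _).
    rewrite ler_wpM2l// distrC (le_trans _ (lerB_dist _ _))// !normrX.
    by rewrite lerB// exprn_ile1// ltW.
  rewrite -SE normrM mulrCA -normrM.
  rewrite -hornerM (le_trans (ler_wpM2l _ H))//.
  by rewrite normrM le_eqVlt; apply/orP; left; apply/eqP; ring.
rewrite hornerM real_leNgt ?ger0_real ?mulr_ge0//; apply/negP => lt.
set x := `|N.[z]| in lt NS; set y := c * _ in lt NS.
have xy0 : 0 < x - y by rewrite subr_gt0.
have [K KP] := exprn_unbounded ((x + y) / (x - y)) r1.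
have x0 : 0 <= x by exact: normr_ge0.
have y0 : 0 <= y by rewrite mulr_ge0.
have rK : 0 <= `|r| ^+ K by rewrite exprn_ge0.
have := NS K; apply/negP; rewrite -real_ltNge; last 2 first.
- exact: ger0_real (mulr_ge0 y0 (addr_ge0 rK ler01)).
- by rewrite realM ?realB ?ger0_real.
rewrite normrM ger0_norm in KP; last by rewrite addr_ge0// mulr_ge0.
rewrite normfV (gtr0_norm xy0) ltr_pdivrMr// in KP.
rewrite -subr_gt0; move: KP; rewrite -subr_gt0.
by congr (0 < _); ring.
Qed.

End Circle.

(** * The Fejer-Riesz theorem *)

Section FejerRiesz.
Variable R : realType.
Local Notation C := R[i].
Implicit Types (z w c : C) (P Q D g : {poly C}).

Lemma conj_rev_circle n g z : (size g <= n.+1)%N -> circle z ->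
  (conj_rev n g).[z] = z ^+ n * (g.[z])^*.
Proof.
by move=> sg z1; rewrite conj_revE ?circle_neq0// (circle_conj z1) invrK.
Qed.

Lemma norm_conj_factor w z : circle z -> `|1 - w^* * z| = `|z - w|.
Proof.
move=> z1; have -> : 1 - w^* * z = z * (z - w)^*.
  rewrite rmorphB/= (circle_conj z1) mulrBr divff ?circle_neq0//.
  by rewrite [z * _]mulrC.
by rewrite normrM norm_conjC z1 mul1r.
Qed.

(** The pair of reflected zeros w and 1 / conj w is nonnegative on the circle,
once divided by z. *)
Lemma conj_factor_circle w z : circle z ->
  (z - w) * (1 - w^* * z) = z * `|z - w| ^+ 2.
Proof.
move=> z1; rewrite normCK rmorphB/= (circle_conj z1) mulrCA; congr (_ * _).
by rewrite mulrBr divff ?circle_neq0// [z * _]mulrC.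
Qed.

Lemma conj_factor_neq0 w z : open_disc w -> closed_disc z -> 1 - w^* * z != 0.
Proof.
rewrite /open_disc /closed_disc/= => w1 z1; rewrite subr_eq0; apply/eqP => e.
have : `|w^* * z| < 1.
  rewrite normrM norm_conjC; apply: le_lt_trans w1.
  by rewrite ler_piMr.
by rewrite -e normr1 ltxx.
Qed.

Lemma horner_conj_factor w z : (1 - w^* *: 'X).[z] = 1 - w^* * z.
Proof. by rewrite !hornerE. Qed.

Lemma self_inversive n P : (size P <= (n.*2).+1)%N ->
  (forall z, circle z -> 0 < z ^- n * P.[z]) -> conj_rev n.*2 P = P.
Proof.
move=> sP Pp; apply: poly_circle_eq => z z1; have z0 := circle_neq0 z1.
rewrite conj_rev_circle// -addnn exprD -mulrA.
have -> : z ^+ n * (P.[z])^* = z ^- n * P.[z].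
  have /ltW/geC0_conj := Pp _ z1.
  rewrite rmorphM/= rmorphV ?unitfE ?expf_neq0// rmorphXn/= circle_conj//.
  by rewrite exprVn invrK.
by rewrite mulVKf// expf_neq0.
Qed.

Lemma self_inversive_root_conj n P w : (size P <= n.+1)%N -> conj_rev n P = P ->
  w != 0 -> root P w -> root P (w^*)^-1.
Proof.
move=> sP Pc w0 /eqP Pw; apply/eqP; rewrite -Pc conj_revE//; last first.
  by rewrite invr_eq0 conjC_eq0.
have -> : (((w^*)^-1)^*)^-1 = w by rewrite fmorphV/= conjCK invrK.
by rewrite Pw conjC0 mulr0.
Qed.

(** Reflection in the circle exchanges the roots inside and outside.  A root at 0
has its mirror image at infinity: it is visible as a drop of the degree below
2 n, which is why the case P(0) = 0 is separate. *)
Lemma positive_root_in_disc n P : (0 < n)%N -> (size P <= (n.*2).+1)%N ->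
  (forall z, circle z -> 0 < z ^- n * P.[z]) ->
  exists2 w, open_disc w & root P w.
Proof.
move=> n0 sP Pp; have Pc := self_inversive sP Pp.
have [P0|P0] := eqVneq P`_0 0.
  by exists 0; [rewrite /open_disc/= normr0|rewrite /root horner_coef0 P0].
have P2n : P`_(n.*2) = (P`_0)^*.
  by rewrite -[in LHS]Pc coef_poly ltnS leqnn subnn.
have sP1 : size P != 1.
  apply/eqP => sP1; move: P2n; rewrite nth_default ?sP1 ?double_gt0//.
  by move/esym/eqP; rewrite conjC_eq0 (negbTE P0).
have [w Pw] := closed_rootP _ sP1.
have w0 : w != 0.
  by apply: contraNneq P0 => w0; move: Pw; rewrite w0 /root horner_coef0.
have [w1|w1|w1] := real_ltgtP (normr_real w) (real1 _).
- by exists w.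
- exists (w^*)^-1; last exact: (self_inversive_root_conj sP Pc w0 Pw).
  rewrite /open_disc/= normfV norm_conjC.
  by rewrite invf_lt1// normr_gt0.
- by have := Pp _ w1; rewrite (eqP Pw) mulr0 ltxx.
Qed.

Lemma self_inversive_factor n P w :
  (size P <= (n.*2).+1)%N -> conj_rev n.*2 P = P ->
  open_disc w -> root P w ->
  exists2 Q : {poly C}, (size Q <= (n.*2).-1)%N
    & P = Q * (('X - w%:P) * (1 - w^* *: 'X)).
Proof.
move=> sP Pc w1 Pw; have [w0|w0] := eqVneq w 0.
  move: Pw; rewrite w0 => /factor_theorem[Q PQ].
  (* The mirror image of w = 0 is at infinity, so only one linear factor splits
     off, and the top coefficient of P vanishes with P(0). *)
  have e : 1 - (0 : C)^* *: 'X = 1 :> {poly C} by rewrite conjC0 scale0r subr0.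
  exists Q; last by rewrite PQ e mulr1.
  have [->|Q0] := eqVneq Q 0; first by rewrite size_poly0.
  suff : (size P <= n.*2)%N.
    by rewrite PQ size_Mmonic ?monicXsubC// size_XsubC addn2/=; lia.
  apply/leq_sizeP => j; rewrite leq_eqVlt => /orP[/eqP <-|lt]; last first.
    by rewrite nth_default// (leq_trans sP).
  rewrite -[P]Pc coef_poly ltnS leqnn subnn PQ -horner_coef0.
  by rewrite !hornerE ?oppr0 ?addr0 ?mulr0 conjC0.
have Pw' := self_inversive_root_conj sP Pc w0 Pw.
have /factor_theorem[P1 PP1] := Pw.
have ww' : (w^*)^-1 != w.
  apply/eqP => /(congr1 Num.norm); rewrite normfV norm_conjC => e.
  have : `|w|^-1 * `|w| < 1 by rewrite e mulr_ilt1.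
  by rewrite mulVf ?normr_eq0// ltxx.
have /factor_theorem[P2 PP2] : root P1 (w^*)^-1.
  move: Pw'; rewrite PP1 rootM root_XsubC.
  by rewrite [_ == w](negbTE ww') orbF.
exists (- (w^*)^-1 *: P2).
  have [->|P20] := eqVneq P2 0; first by rewrite scaler0 size_poly0.
  rewrite size_scale ?oppr_eq0 ?invr_eq0 ?conjC_eq0//.
  move: sP; rewrite PP1 PP2.
  rewrite !size_Mmonic ?monicXsubC ?mulf_neq0 ?polyXsubC_eq0//.
  by rewrite !size_XsubC !addn2/=; case: (n.*2).
have -> : 1 - w^* *: 'X = - w^* *: ('X - (w^*)^-1%:P).
  rewrite scalerBr !scaleNr opprK -[_ *: _%:P]mul_polyC -polyCM.
  by rewrite divff ?conjC_eq0// addrC.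
rewrite PP1 PP2 -scalerAr -scalerAl -scalerAr scalerA mulrNN mulVf ?conjC_eq0//.
by rewrite scale1r -mulrA [_ * ('X - w%:P)]mulrC.
Qed.

Lemma size_polyM_leq j k (p q : {poly C}) :
  (size p <= j.+1)%N -> (size q <= k.+1)%N -> (size (p * q)%R <= (j + k).+1)%N.
Proof.
move=> sp sq; rewrite (leq_trans (size_polyMleq _ _))//.
by rewrite -subn1 leq_subLR add1n -addSn -addnS leq_add.
Qed.

Lemma size_conj_factor w : (size (1 - w^* *: 'X : {poly C})%R <= 2)%N.
Proof.
rewrite (leq_trans (size_polyD _ _))// size_polyN geq_max size_poly1/=.
by rewrite (leq_trans (size_scale_leq _ _))// size_polyX.
Qed.

(** Split off a root w in the disc together with its mirror image.  On the
circle the two factors contribute |z - w|^2 = |1 - conj w z|^2, and it is the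
second form, without zeros in the closed disc, that goes into D. *)
Lemma fejer_riesz n P : (size P <= (n.*2).+1)%N ->
  (forall z, circle z -> 0 < z ^- n * P.[z]) ->
  exists D : {poly C}, [/\ (size D <= n.+1)%N,
      forall z, closed_disc z -> D.[z] != 0
    & forall z, circle z -> z ^- n * P.[z] = `|D.[z]| ^+ 2].
Proof.
elim: n P => [|n IH] P sP Pp.
  rewrite (size1_polyC sP) in Pp *.
  have := Pp 1 (normr1 _); rewrite expr0 invr1 mul1r hornerC => P0.
  exists (sqrtC P`_0)%:P; split.
  - exact: size_polyC_leq1.
  - by move=> z _; rewrite hornerC sqrtC_eq0 gt_eqF.
  - by move=> z _; rewrite mul1r !hornerC -normrX sqrtCK gtr0_norm.
have [w w1 Pw] := positive_root_in_disc (ltn0Sn n) sP Pp.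
have [Q sQ PQ] := self_inversive_factor sP (self_inversive sP Pp) w1 Pw.
have PQz z : circle z -> z ^- n.+1 * P.[z] = z ^- n * Q.[z] * `|z - w| ^+ 2.
  move=> z1; rewrite PQ 2!hornerM hornerXsubC horner_conj_factor.
  rewrite conj_factor_circle// exprS invfM.
  have z0 := circle_neq0 z1; have zn0 : z ^+ n != 0 by exact: expf_neq0.
  by field; rewrite zn0 z0.
have zw z : circle z -> 0 < `|z - w| ^+ 2.
  move=> z1; rewrite exprn_gt0// normr_gt0 subr_eq0; apply/eqP => e.
  by move: w1; rewrite /open_disc/= -e z1 ltxx.
have [|z z1|D [sD D0 DQ]] := IH Q.
- by rewrite (leq_trans sQ).
- by have := Pp z z1; rewrite PQz// pmulr_lgt0// zw.
exists (D * (1 - w^* *: 'X)); split.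
- by rewrite -[n.+1]addn1 size_polyM_leq// size_conj_factor.
- move=> z z1; rewrite hornerM horner_conj_factor mulf_neq0 ?D0//.
  exact: conj_factor_neq0.
- move=> z z1; rewrite PQz// DQ// hornerM normrM exprMn; congr (_ * _ ^+ 2).
  by rewrite horner_conj_factor norm_conj_factor.
Qed.

End FejerRiesz.

(** * Rational functions as quotients of polynomials *)

Section Rational.
Variable R : realType.
Local Notation C := R[i].
Implicit Types (N Q p : {poly C}) (z : C).

Lemma derivable_polyC p z : derivable (horner p : C -> C) z 1.
Proof.
elim/poly_ind: p => [|p r ih].
  rewrite (_ : horner 0 = cst 0) //; last by apply/funext => w; rewrite horner0.
have -> : horner (p * 'X + r%:P) = (horner p * (id : C -> C)) + cst r.
  by apply/funext => w; rewrite !hornerE.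
apply: derivableD; last exact: derivable_cst.
by apply: derivableM; [exact: ih|exact: derivable_id].
Qed.

Lemma continuous_derivable (f : C -> C) z :
  derivable f z 1 -> {for z, continuous f}.
Proof. by move/derivable1_diffP/differentiable_continuous. Qed.

Lemma derivable_rat_eval N Q z : Q.[z] != 0 ->
  derivable (rat_eval (tofrac N / tofrac Q) : C -> C) z 1.
Proof.
move=> Qz.
have d : derivable (horner N * (fun w => (Q.[w])^-1) : C -> C) z 1.
  apply: derivableM; first exact: derivable_polyC.
  by apply: derivableV => //; exact: derivable_polyC.
apply: near_eq_derivable d.
have Qc : {for z, continuous (horner Q : C -> C)}.
  exact/continuous_derivable/derivable_polyC.
near=> w; rewrite rat_evalE//.
by near: w; exact: (cvgr_neq0 _ Qc Qz).
Unshelve. all: by end_near. Qed.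

Lemma rnum_rden_coprime (f : ratfun R) : coprimep (rnum f) (rden f).
Proof. by apply: coprimep_div_gcd; apply/orP; right; exact: denom_ratioP. Qed.

Lemma rden_neq0 (f : ratfun R) : rden f != 0.
Proof.
have d0 : (repr f).2 != 0 by exact: denom_ratioP.
by rewrite /rden dvdp_div_eq0 ?dvdp_gcdr.
Qed.

Lemma rnum_dvd N Q : Q != 0 -> rnum (tofrac N / tofrac Q) %| N.
Proof.
move=> Q0; have e := rnum_rdenE N Q0; set f := _ / _ in e *.
by rewrite -(Gauss_dvdpl _ (rnum_rden_coprime f)) -e dvdp_mulr.
Qed.

Lemma rden_dvd N Q : Q != 0 -> rden (tofrac N / tofrac Q) %| Q.
Proof.
move=> Q0; have e := rnum_rdenE N Q0; set f := _ / _ in e *.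
have cop : coprimep (rden f) (rnum f).
  by rewrite coprimep_sym rnum_rden_coprime.
by rewrite -(Gauss_dvdpr _ cop) e dvdp_mull.
Qed.

Lemma rat_deg_le N Q k : Q != 0 -> (size N <= k.+1)%N -> (size Q <= k.+1)%N ->
  (rat_deg (tofrac N / tofrac Q) <= k)%N.
Proof.
move=> Q0 sN sQ; have dn := rnum_dvd N Q0; have dd := rden_dvd N Q0.
have e := rnum_rdenE N Q0; set f := _ / _ in e dn dd *.
rewrite /rat_deg -ltnS prednK.
  rewrite geq_max; apply/andP; split.
    have [N0|N0] := eqVneq N 0; last by rewrite (leq_trans (dvdp_leq N0 dn)).
    move: e; rewrite N0 mul0r => /eqP.
    by rewrite mulf_eq0 (negbTE Q0) orbF => /eqP ->; rewrite size_poly0.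
  by rewrite (leq_trans (dvdp_leq Q0 dd)).
by rewrite leq_max size_poly_gt0 orbC lt0n size_poly_eq0 rden_neq0.
Qed.

Lemma mup_rnum N Q z : N != 0 -> Q.[z] != 0 ->
  mup z (rnum (tofrac N / tofrac Q)) = mup z N.
Proof.
move=> N0 Qz; have Q0 : Q != 0 by apply: contraNneq Qz => ->; rewrite horner0.
have e := rnum_rdenE N Q0; have dd := rden_dvd N Q0.
set f := _ / _ in e dd *.
have dz : ~~ root (rden f) z.
  apply: contra Qz; rewrite -dvdp_XsubCl => /dvdp_trans/(_ dd).
  by rewrite dvdp_XsubCl.
rewrite -(@mupMl _ z (rnum f) Q); last by rewrite /root Qz.
by rewrite e mupMl.
Qed.

(** Nonemptiness of S is what makes Q nonzero, so that the fraction is nonzero. *)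
Lemma zeros_are_frac (S : set C) N Q (zs : seq C) : N != 0 ->
  (forall z, S z -> Q.[z] != 0) -> (exists z, S z) ->
  (forall z, count_mem z zs = if z \in S then mup z N else 0%N) ->
  zeros_are S (tofrac N / tofrac Q) zs.
Proof.
move=> N0 QS [z0 Sz0] H; split; last first.
  move=> z; rewrite H; case: ifPn => // /[!inE] Sz; rewrite mup_rnum// QS//.
have Q0 : Q != 0.
  by have := QS _ Sz0; apply: contraNneq => ->; rewrite horner0.
by rewrite mulf_neq0 ?invr_eq0 ?tofrac_eq0.
Qed.

End Rational.

(** * Contractions and the closed pentablock *)

Section Pentablock.
Variable R : realType.
Local Notation C := R[i].

Lemma continuous_triple (f g h : C -> C) z :
  {for z, continuous f} -> {for z, continuous g} -> {for z, continuous h} ->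
  {for z, continuous (fun w => (f w, g w, h w))}.
Proof. by move=> fc gc hc; exact: (cvg_pair (cvg_pair fc gc) hc). Qed.

Lemma l2norm_le n (u v : 'cV[C]_n) :
  \sum_i `|u i 0| ^+ 2 <= \sum_i `|v i 0| ^+ 2 -> l2norm u <= l2norm v.
Proof.
have sqE (w : 'cV[C]_n) : \sum_i `|w i 0| ^+ 2 =
    (\sum_i ComplexField.Normc.normc (w i 0) ^+ 2)%:C%C.
  by rewrite rmorph_sum; apply: eq_bigr => i _; rewrite rmorphXn.
by rewrite !sqE lecR => uv; rewrite ler_wsqrtr.
Qed.

Lemma l2normZ n (r : R) (v : 'cV[C]_n) : 0 <= r ->
  l2norm (r%:C%C *: v) = r * l2norm v.
Proof.
move=> r0; rewrite /l2norm -[r in RHS]ger0_norm// -sqrtr_sqr -sqrtrM ?sqr_ge0//.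
congr Num.sqrt; rewrite mulr_sumr; apply: eq_bigr => i _.
rewrite mxE ComplexField.Normc.normcM exprMn; congr (_ ^+ 2 * _).
by rewrite /= expr0n/= addr0 sqrtr_sqr ger0_norm.
Qed.

Lemma opnorm_scale_lt1 n (M : 'M[C]_n) (r : R) : 0 <= r < 1 ->
  (forall v, l2norm (M *m v) <= l2norm v) -> opnorm (r%:C%C *: M) < 1.
Proof.
case/andP=> r0 r1 Mc; apply: le_lt_trans r1; apply: ge_sup.
  have l0 : l2norm (0 : 'cV[C]_n) = 0.
    rewrite /l2norm big1 ?sqrtr0// => i _.
    by rewrite mxE ComplexField.Normc.normc0 expr0n.
  by exists 0, 0; rewrite /= ?mulmx0 l0.
move=> _ [v /= v1 <-]; rewrite -scalemxAl l2normZ//.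
by rewrite ler_piMr// (le_trans (Mc v)).
Qed.

(** For 0 <= r < 1 the matrix r M lies in the open unit ball; let r tend to 1. *)
Lemma contraction_closure_pentablock (a11 a12 a21 a22 : C) :
  (forall v1 v2, `|a11 * v1 + a12 * v2| ^+ 2 + `|a21 * v1 + a22 * v2| ^+ 2
     <= `|v1| ^+ 2 + `|v2| ^+ 2) ->
  closure (@pentablock R) (a21, a11 + a22, a11 * a22 - a12 * a21).
Proof.
move=> Mc; set x := (_, _, _).
pose M : 'M[C]_2 := \matrix_(i, j)
  (if i == 0 then if j == 0 then a11 else a12 else if j == 0 then a21 else a22).
have Ml v : l2norm (M *m v) <= l2norm v.
  apply: l2norm_le; rewrite !big_ord_recl !big_ord0 !addr0 !mxE.
  rewrite !big_ord_recl !big_ord0 !addr0 !mxE/=.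
  exact: Mc.
pose g (r : C) : C * C * C :=
  (r * a21, r * (a11 + a22), r * r * (a11 * a22 - a12 * a21)).
have gc : {for 1, continuous g}.
  apply: continuous_triple; [exact: mulrr_continuous|exact: mulrr_continuous|].
  set d := a11 * a22 - _; rewrite (_ : (fun _ => _) = horner (d *: 'X^2)).
    exact/continuous_derivable/derivable_polyC.
  by apply/funext => r; rewrite hornerZ hornerXn expr2 mulrC.
have gP (r : R) : 0 <= r < 1 -> pentablock (g r%:C%C).
  move=> r01; exists (r%:C%C *: M); first exact: opnorm_scale_lt1.
  rewrite /g !mxE/=; congr (_, _, _).
    by rewrite /mxtrace !big_ord_recl !big_ord0 !addr0 !mxE/= mulrDr.
  rewrite (expand_det_row _ 0) !big_ord_recl big_ord0 addr0 !mxE/=.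
  by rewrite /cofactor !det_mx11 !mxE/=; ring.
move=> U; have -> : x = g 1 by rewrite /g !mul1r.
move=> /gc /nbhs_ballP[e /= e0 eU].
have eE : e = (complex.Re e)%:C%C by rewrite RRe_real// gtr0_real.
set q := complex.Re e in eE.
have q0 : 0 < q by rewrite -ltcR -eE.
(* This r satisfies 0 <= r < 1 and 1 - r = q / (1 + q) < q. *)
pose r := (1 + q)^-1.
have q1 : 0 < 1 + q by rewrite addr_gt0.
exists (g r%:C%C); split.
  by apply: gP; rewrite invr_ge0 ltW//= invf_lt1// ltrDl.
apply: eU; rewrite -ball_normE /ball_/= eE -(rmorph1 (real_complex R)) -rmorphB.
have -> : 1 - r = q / (1 + q) by rewrite /r; field; rewrite gt_eqF.
rewrite ger0_norm ?ler0c ?divr_ge0 ?ltW// ltcR ltr_pdivrMr//.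
by rewrite mulrDr mulr1 ltrDl mulr_gt0.
Qed.

(** The matrix [[x, - y^*], [y, x^*]] is a scalar multiple of a unitary matrix. *)
Lemma norm_rotate (x y v1 v2 : C) :
  `|x * v1 - y^* * v2| ^+ 2 + `|y * v1 + x^* * v2| ^+ 2 =
  (`|x| ^+ 2 + `|y| ^+ 2) * (`|v1| ^+ 2 + `|v2| ^+ 2).
Proof.
by rewrite !normCK rmorphB rmorphD !rmorphM/= !conjCK; ring.
Qed.

Lemma polar_decomposition (w : C) : exists2 u : C, `|u| = 1 & w = `|w| * u.
Proof.
have [->|w0] := eqVneq w 0; first by exists 1; rewrite ?normr1// normr0 mul0r.
exists (w / `|w|); first by rewrite normrM normfV normr_id divff ?normr_eq0.
by rewrite mulrCA divff ?mulr1 ?normr_eq0.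
Qed.

(** Here b x^2 - c y^2 is the lower left entry of U^* M U for
M = [[h, c], [b, h]] and U = [[x, - y^*], [y, x^*]].  The phases of x and y are
chosen to align b x^2 and c y^2 with zeta b; then only the modulus is left, and
u = |x|^2 moves it linearly from - |c| at u = 0 to |b| at u = 1, through
|zeta| |b|. *)
Lemma rotate_shrinks_corner (b c zeta : C) : `|zeta| <= 1 ->
  exists x y : C, `|x| ^+ 2 + `|y| ^+ 2 = 1
    /\ b * x ^+ 2 - c * y ^+ 2 = zeta * b.
Proof.
move=> z1.
have [beta b1 bE] := polar_decomposition b.
have [gamma c1 cE] := polar_decomposition c.
have [xi xi1 zE] := polar_decomposition zeta.
pose u := (`|zeta| * `|b| + `|c|) / (`|b| + `|c|).
have d0 : 0 <= `|b| + `|c| by rewrite addr_ge0.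
have num0 : 0 <= `|zeta| * `|b| + `|c| by rewrite addr_ge0// mulr_ge0.
have numle : `|zeta| * `|b| + `|c| <= `|b| + `|c| by rewrite lerD2r ler_piMl.
have u0 : 0 <= u by rewrite divr_ge0.
(* When b = c = 0 the default value u = 0 of the division is good enough. *)
have uE : (`|b| + `|c|) * u = `|zeta| * `|b| + `|c|.
  have [d00|d00] := eqVneq (`|b| + `|c|) 0.
    rewrite d00 mul0r; apply/eqP; rewrite eq_le num0.
    by rewrite -d00 numle.
  by rewrite mulrC divfK.
have u1 : u <= 1.
  have [d00|d00] := eqVneq (`|b| + `|c|) 0; first by rewrite /u d00 invr0 mulr0.
  by rewrite ler_pdivrMr ?mul1r// lt_def d00.
have v0 : 0 <= 1 - u by rewrite subr_ge0.
have g0 : gamma != 0 by rewrite -normr_eq0 c1 oner_eq0.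
exists (sqrtC u * sqrtC xi), (sqrtC (1 - u) * sqrtC (beta * xi / gamma)).
have mu1 : `|sqrtC xi| = 1 by exact: unimodular_sqrt.
have tau1 : `|sqrtC (beta * xi / gamma)| = 1.
  by apply: unimodular_sqrt; rewrite !normrM normfV b1 xi1 c1 invr1 !mulr1.
rewrite !(normrM (sqrtC _)) mu1 tau1 !mulr1 -!normrX !exprMn !sqrtCK.
rewrite !ger0_norm//; split; first by rewrite addrC subrK.
rewrite bE cE zE.
transitivity (beta * xi * ((`|b| + `|c|) * u - `|c|)); first by field.
by rewrite uE; ring.
Qed.

(** The entries a11, ..., a22 below are those of U^* M U, with U as in
[rotate_shrinks_corner]. *)
Lemma contraction_shrink_corner (h b c zeta : C) : `|zeta| <= 1 ->
  (forall v1 v2, `|h * v1 + c * v2| ^+ 2 + `|b * v1 + h * v2| ^+ 2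
     <= `|v1| ^+ 2 + `|v2| ^+ 2) ->
  closure (@pentablock R) (zeta * b, 2 * h, h ^+ 2 - b * c).
Proof.
move=> z1 Mc; have [x [y [xy1 e]]] := rotate_shrinks_corner b c z1.
have xyC : x * x^* + y * y^* = 1 by rewrite -!normCK.
pose a11 := x^* * (h * x + c * y) + y^* * (b * x + h * y).
pose a12 := x^* * (c * x^* - h * y^*) + y^* * (h * x^* - b * y^*).
pose a21 := x * (b * x + h * y) - y * (h * x + c * y).
pose a22 := x * (h * x^* - b * y^*) - y * (c * x^* - h * y^*).
have -> : zeta * b = a21 by rewrite -e /a21; ring.
have -> : 2 * h = a11 + a22.
  transitivity (2 * h * (x * x^* + y * y^*)); first by rewrite xyC mulr1.
  by rewrite /a11 /a22; ring.
have -> : h ^+ 2 - b * c = a11 * a22 - a12 * a21.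
  transitivity ((h ^+ 2 - b * c) * (x * x^* + y * y^*) ^+ 2).
    by rewrite xyC expr1n mulr1.
  by rewrite /a11 /a22 /a12 /a21; ring.
apply: contraction_closure_pentablock => v1 v2.
pose w1 := x * v1 - y^* * v2; pose w2 := y * v1 + x^* * v2.
pose t1 := h * w1 + c * w2; pose t2 := b * w1 + h * w2.
have -> : a11 * v1 + a12 * v2 = x^* * t1 - (- y)^* * t2.
  by rewrite rmorphN/= /a11 /a12 /t1 /t2 /w1 /w2; ring.
have -> : a21 * v1 + a22 * v2 = - y * t1 + (x^*)^* * t2.
  by rewrite conjCK /a21 /a22 /t1 /t2 /w1 /w2; ring.
rewrite norm_rotate norm_conjC normrN xy1 mul1r.
by rewrite (le_trans (Mc _ _))// norm_rotate xy1 mul1r.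
Qed.

End Pentablock.

(** * The polynomials R and E *)

Section Spectral.
Variable R : realType.
Local Notation C := R[i].
Implicit Types (z w c : C).

(** For polynomials of size at most k + 1 this is p = conj_rev k p; evaluated on
the circle, it multiplies without any bound on the sizes. *)
Definition self_reciprocal k (p : {poly C}) : Prop :=
  forall z, circle z -> p.[z] = z ^+ k * (p.[z])^*.

Lemma self_reciprocalM j k (p q : {poly C}) :
  self_reciprocal j p -> self_reciprocal k q -> self_reciprocal (j + k) (p * q).
Proof.
move=> hp hq z z1; rewrite hornerM [in LHS]hp// [in LHS]hq// rmorphM/= exprD.
by rewrite mulrACA.
Qed.

Lemma self_reciprocal_prod (I : Type) k (s : seq I) (F : I -> {poly C}) :
  (forall i, self_reciprocal k (F i)) ->
  self_reciprocal (k * size s) (\prod_(i <- s) F i).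
Proof.
move=> hF; elim: s => [|i s IH] /=.
  by move=> z _; rewrite big_nil muln0 hornerC conjC1 mulr1.
by rewrite big_cons mulnS; apply: self_reciprocalM.
Qed.

Lemma size_prod_leqM (I : Type) k (s : seq I) (F : I -> {poly C}) :
  (forall i, (size (F i) <= k.+1)%N) ->
  (size (\prod_(i <- s) F i)%R <= (k * size s).+1)%N.
Proof.
move=> hF; elim: s => [|i s IH] /=; first by rewrite big_nil size_poly1.
by rewrite big_cons mulnS size_polyM_leq.
Qed.

Lemma mup_prod_count (I : eqType) z (s : seq I) (F : I -> {poly C})
    (f : I -> C) :
  (forall i, i \in s -> F i != 0 /\ mup z (F i) = (f i == z)) ->
  mup z (\prod_(i <- s) F i) = count_mem z (map f s).
Proof.
elim: s => [|i s IH] hF /=; first by rewrite big_nil mupNroot// root1.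
have [Fi0 Fi] := hF i (mem_head _ _).
have hs j : j \in s -> F j != 0 /\ mup z (F j) = (f j == z).
  by move=> js; apply: hF; rewrite inE js orbT.
rewrite big_cons mupM// ?IH ?Fi//.
by rewrite prodf_seq_neq0; apply/allP => j /hs[].
Qed.

Lemma size_conj_pair w :
  (size (('X - w%:P) * (1 - w^* *: 'X) : {poly C})%R <= 3)%N.
Proof.
by rewrite (@size_polyM_leq _ 1 1)// ?size_XsubC// size_conj_factor.
Qed.

Lemma conj_factor_polyneq0 w : 1 - w^* *: 'X != 0 :> {poly C}.
Proof.
apply/eqP => /(congr1 (fun p => p.[0])); rewrite horner_conj_factor horner0.
by rewrite mulr0 subr0 => /eqP; rewrite oner_eq0.
Qed.

Lemma mup_XsubC w z : mup z ('X - w%:P) = (w == z).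
Proof. by have := mup_XsubCX 1 z w; rewrite expr1 eq_sym; case: eqP. Qed.

Lemma mup_conj_pair w z : open_disc w -> closed_disc z ->
  mup z (('X - w%:P) * (1 - w^* *: 'X)) = (w == z).
Proof.
move=> w1 z1; rewrite mupMl ?mup_XsubC//.
by rewrite /root horner_conj_factor conj_factor_neq0.
Qed.

Lemma circle_closed z : circle z -> closed_disc z.
Proof. by rewrite /closed_disc /circle/= => ->. Qed.

Lemma open_closed z : open_disc z -> closed_disc z.
Proof. exact: ltW. Qed.

Lemma closed_disc_cases z : closed_disc z -> open_disc z \/ circle z.
Proof.
by rewrite /closed_disc/= le_eqVlt => /orP[/eqP|]; [right|left].
Qed.

Lemma circle_Rpoly tp (sigma : seq C) z : circle z ->
  z ^- (size sigma) * (Rpoly tp sigma).[z] =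
  tp%:C%C * \prod_(w <- sigma) `|z - w| ^+ 2.
Proof.
move=> z1; rewrite /Rpoly hornerZ horner_prod mulrCA; congr (_ * _).
elim: sigma => [|w s IH]; first by rewrite !big_nil expr0 invr1 mulr1.
rewrite !big_cons /= exprS invfM -IH hornerM hornerXsubC horner_conj_factor.
rewrite conj_factor_circle//.
have z0 := circle_neq0 z1; have zn0 : z ^+ size s != 0 by exact: expf_neq0.
by field; rewrite zn0 z0.
Qed.

Lemma size_Rpoly tp (sigma : seq C) :
  (size (Rpoly tp sigma) <= (size sigma).*2.+1)%N.
Proof.
rewrite (leq_trans (size_scale_leq _ _))//.
rewrite -mul2n size_prod_leqM// => w; exact: size_conj_pair.
Qed.

(** The factor 1 - conj w z has a zero in the closed disc only if |w| = 1, and then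
this zero is w itself. *)
Lemma root_Rpoly tp (sigma : seq C) z : 0 < tp ->
  (forall w, w \in sigma -> closed_disc w) -> closed_disc z ->
  ((Rpoly tp sigma).[z] == 0) = (z \in sigma).
Proof.
move=> tp0 s1 z1; rewrite /Rpoly hornerZ mulf_eq0.
have -> : (tp%:C%C == 0) = false by apply: gt_eqF; rewrite (ltcR 0).
rewrite orFb horner_prod prodf_seq_eq0.
apply/hasP/idP => [[w ws]|zs]; last first.
  by exists z => //=; rewrite hornerM hornerXsubC subrr mul0r.
rewrite /= hornerM hornerXsubC horner_conj_factor mulf_eq0 => /orP[|].
  by rewrite subr_eq0 => /eqP ->.
have [w1|w1] := closed_disc_cases (s1 _ ws).
  by rewrite (negbTE (conj_factor_neq0 w1 z1)).
rewrite (circle_conj w1) subr_eq0 => /eqP e.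
by rewrite -[z](mulVKf (circle_neq0 w1)) -e mulr1.
Qed.

Lemma cisD (a b : R) : cis (a + b) = cis a * cis b.
Proof.
apply/eqP; rewrite eq_complex /= cosD sinD.
by apply/andP; split; apply/eqP; ring.
Qed.

Lemma cis_conj (a : R) : (cis a)^* = cis (- a).
Proof. by rewrite /cis cosN sinN. Qed.

Lemma normr_cis (a : R) : `|cis a| = 1.
Proof. by rewrite normc_def /= cos2Dsin2 sqrtr1. Qed.

Lemma cis_neq0 (a : R) : cis a != 0.
Proof. by rewrite -normr_eq0 normr_cis oner_eq0. Qed.

Lemma cis_surj z : circle z -> exists th : R, 0 <= th < 2 * pi /\ z = cis th.
Proof.
case: z => x y; rewrite /circle/= normc_def/= => -[xy].
have xy1 : x ^+ 2 + y ^+ 2 = 1.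
  rewrite -(sqr_sqrtr (_ : 0 <= x ^+ 2 + y ^+ 2)) ?xy ?expr1n//.
  by rewrite addr_ge0// sqr_ge0.
have x1 : -1 <= x <= 1.
  rewrite -ler_norml -sqrtr_sqr -[leRHS]sqrtr1 ler_wsqrtr//.
  by rewrite -xy1 lerDl sqr_ge0.
have yE : Num.sqrt (1 - x ^+ 2) = `|y|.
  by rewrite -xy1 addrAC subrr add0r sqrtr_sqr.
have pi0 := pi_gt0 R.
have [y0|y0] := leP 0 y.
  exists (acos x); split; last by rewrite /cis acosK// sin_acos// yE ger0_norm.
  by rewrite acos_ge0//= (le_lt_trans (acos_lepi x1))// ltr_pMl// ltr1n.
exists (2 * pi - acos x); split; last first.
  have -> : 2 * pi - acos x = - acos x + pi *+ 2 by rewrite addrC mulr_natl.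
  rewrite /cis cosD2pi sinD2pi cosN sinN acosK// sin_acos// yE ltr0_norm//.
  by rewrite opprK.
apply/andP; split.
  rewrite subr_ge0 (le_trans (acos_lepi x1))// ler_pMl// ler1n//.
rewrite gtrBl acos_gt0//; case/andP: x1 => -> /=.
rewrite le_eqVlt => /orP[/eqP e|//].
move: xy1; rewrite e expr1n => /(canRL (addKr _)); rewrite addNr => /eqP.
by rewrite sqrf_eq0 => /eqP e0; rewrite e0 ltxx in y0.
Qed.

Lemma size_Epoly t (alpha : seq C) (theta : seq R) :
  (size (Epoly t alpha theta) <= (2 * size alpha + size theta).+1)%N.
Proof.
rewrite (leq_trans (size_scale_leq _ _))//.
have h1 := @size_prod_leqM _ 2 alpha _ size_conj_pair.
have h2 := @size_prod_leqM _ 1 theta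
  (fun th => ('i%C * cis (- th / 2)) *: ('X - (cis th)%:P)) _.
have hf th :
    (size (('i%C * cis (- th / 2)) *: ('X - (cis th)%:P) : {poly C})%R <= 2)%N.
  by rewrite (leq_trans (size_scale_leq _ _))// size_XsubC.
by apply: size_polyM_leq => //; move: (h2 hf); rewrite mul1n.
Qed.

Lemma self_reciprocal_Epoly t (alpha : seq C) (theta : seq R) :
  self_reciprocal (2 * size alpha + size theta) (Epoly t alpha theta).
Proof.
have hp : self_reciprocal (2 * size alpha + size theta)
    (\prod_(w <- alpha) (('X - w%:P) * (1 - w^* *: 'X)) *
     \prod_(th <- theta) (('i%C * cis (- th / 2)) *: ('X - (cis th)%:P))).
  apply: self_reciprocalM.
    apply: self_reciprocal_prod => w z z1.
    rewrite hornerM hornerXsubC horner_conj_factor conj_factor_circle//.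
    rewrite rmorphM/= (circle_conj z1) geC0_conj ?exprn_ge0//.
    by field; rewrite circle_neq0.
  rewrite -[X in self_reciprocal X]mul1n.
  apply: self_reciprocal_prod => th z z1.
  rewrite hornerZ hornerXsubC expr1 !rmorphM rmorphB/= (circle_conj z1).
  rewrite !cis_conj.
  have i1 : ('i%C : C)^* = - 'i%C.
    by apply/eqP; rewrite eq_complex /= oppr0 !eqxx.
  rewrite i1.
  have -> : - (- th / 2) = th + - th / 2 by field.
  rewrite cisD; have := cisD th (- th); rewrite subrr.
  have -> : cis 0 = 1 :> C by rewrite /cis cos0 sin0.
  move=> e; have z0 := circle_neq0 z1.
  (* The constant k = i e^(- i th / 2) satisfies k^2 e^(i th) = -1, which makes
     k (z - e^(i th)) reciprocal of degree 1. *)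
  transitivity ('i%C * cis (- th / 2) * (cis th * cis (- th) * z - cis th)).
    by rewrite -e mul1r.
  by field.
move=> z z1; rewrite /Epoly hornerZ [in LHS]hp// rmorphM/= mulrCA.
congr (_ * (_ * _)).
by apply/eqP; rewrite eq_complex /= oppr0 !eqxx.
Qed.

Lemma Epoly_neq0 t (alpha : seq C) (theta : seq R) : t != 0 ->
  Epoly t alpha theta != 0.
Proof.
move=> t0; rewrite scaler_eq0 negb_or eq_complex/= eqxx andbT t0/=.
rewrite mulf_neq0// prodf_seq_neq0; apply/allP => w _ /=.
  by rewrite mulf_neq0 ?polyXsubC_eq0// conj_factor_polyneq0.
rewrite scaler_eq0 negb_or polyXsubC_eq0 andbT mulf_neq0 ?cis_neq0//.
by rewrite complexiE neq0Ci.
Qed.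

(** The zeros of E outside the closed disc are the mirror images of the alpha_j,
so they do not count. *)
Lemma mup_Epoly t (alpha : seq C) (theta : seq R) z : t != 0 ->
  (forall w, w \in alpha -> open_disc w) -> closed_disc z ->
  mup z (Epoly t alpha theta) = count_mem z (alpha ++ map (@cis R) theta).
Proof.
move=> t0 a1 z1; have := Epoly_neq0 alpha theta t0; rewrite /Epoly -mul_polyC.
set T := _%:P; rewrite mulf_eq0 negb_or => /andP[T0].
rewrite mulf_eq0 negb_or => /andP[P0 Q0].
have tz : ~~ root T z.
  by rewrite rootC; move: T0; rewrite polyC_eq0.
rewrite mupMr// mupM// count_cat; congr addn.
  rewrite -[in RHS](map_id alpha); apply: mup_prod_count => w wa; split.
    by rewrite mulf_neq0 ?polyXsubC_eq0// conj_factor_polyneq0.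
  by rewrite mup_conj_pair//; exact: a1.
apply: mup_prod_count => th _.
have k0 : 'i%C * cis (- th / 2) != 0 :> C.
  by rewrite mulf_neq0 ?cis_neq0// complexiE neq0Ci.
split; first by rewrite scaler_eq0 negb_or polyXsubC_eq0 andbT.
by rewrite -mul_polyC mupMr ?mup_XsubC// rootC.
Qed.

End Spectral.

(** * The inner matrix function *)

Section Inner.
Variable R : realType.
Local Notation C := R[i].
Implicit Types (z w c : C) (D A E : {poly C}).

(** The last condition says that the row (E/2, A) / D has length 1 on the circle.
Together with the reciprocity of E it makes [[E/2, - A~], [A, E/2]] / D
unitary there, where A~ = conj_rev n A. *)
Definition unit_row_data n D A E : Prop :=
  [/\ (size D <= n.+1)%N, (size A <= n.+1)%N,
      (forall z, closed_disc z -> D.[z] != 0), self_reciprocal n E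
    & forall z, circle z ->
        4 * `|A.[z]| ^+ 2 + `|E.[z]| ^+ 2 = 4 * `|D.[z]| ^+ 2].

Lemma self_reciprocal_sqr n E z : self_reciprocal n E -> circle z ->
  E.[z] ^+ 2 = z ^+ n * `|E.[z]| ^+ 2.
Proof. by move=> hE z1; rewrite normCK expr2 {2}(hE _ z1) mulrCA. Qed.

Lemma mul_conj_rev n D z : (size D <= n.+1)%N -> circle z ->
  D.[z] * (conj_rev n D).[z] = z ^+ n * `|D.[z]| ^+ 2.
Proof. by move=> sD z1; rewrite conj_rev_circle// normCK mulrCA. Qed.

Lemma horner_royal n D E z : (royal_poly n D E).[z] =
  4 * (D.[z] * (conj_rev n D).[z]) - E.[z] ^+ 2.
Proof. by rewrite hornerD hornerN hornerZ hornerM horner_exp. Qed.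

Lemma royal_identity n D A E : unit_row_data n D A E ->
  4 *: (A * conj_rev n A) = royal_poly n D E.
Proof.
case=> sD sA D0 hE hDA; apply: poly_circle_eq => z z1.
rewrite horner_royal hornerZ hornerM.
rewrite !mul_conj_rev// (self_reciprocal_sqr hE z1) mulrCA.
rewrite [4 * (_ * `|D.[z]| ^+ 2)]mulrCA.
by rewrite -mulrBr -hDA// addrK.
Qed.

(** With (g1, g2) the image of (v1, v2) under the numerator of the matrix function,
[isom] is its isometry on the circle.  By Cauchy-Schwarz the scalar polynomial
k g1 + l g2 is bounded on the circle, and the choice k = conj (g1(z)),
l = conj (g2(z)) makes its value at z the squared length G to be bounded. *)
Lemma matrix_contraction n D A E z v1 v2 : unit_row_data n D A E ->
  open_disc z ->
  `|E.[z] / 2 * v1 - (conj_rev n A).[z] * v2| ^+ 2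
    + `|A.[z] * v1 + E.[z] / 2 * v2| ^+ 2
  <= `|D.[z]| ^+ 2 * (`|v1| ^+ 2 + `|v2| ^+ 2).
Proof.
case=> sD sA D0 hE hDA z1.
pose g1 := (v1 / 2) *: E - v2 *: conj_rev n A.
pose g2 := v1 *: A + (v2 / 2) *: E.
have g1E w : g1.[w] = E.[w] / 2 * v1 - (conj_rev n A).[w] * v2.
  by rewrite /g1 hornerD hornerN !hornerZ; ring.
have g2E w : g2.[w] = A.[w] * v1 + E.[w] / 2 * v2.
  by rewrite /g2 hornerD !hornerZ; ring.
rewrite -g1E -g2E; set G := _ + _; set U := `|v1| ^+ 2 + _.
have G0 : 0 <= G by rewrite addr_ge0 ?exprn_ge0.
have U0 : 0 <= U by rewrite addr_ge0 ?exprn_ge0.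
have isom w : circle w -> `|g1.[w]| ^+ 2 + `|g2.[w]| ^+ 2 = `|D.[w]| ^+ 2 * U.
  move=> w1; apply: (mulfI (_ : 4 != 0)); first by rewrite pnatr_eq0.
  rewrite mulrA -hDA// g1E g2E conj_rev_circle// /U.
  have hEc : (E.[w])^* = w^-1 ^+ n * E.[w].
    by rewrite {2}(hE _ w1) mulrA -exprMn mulVf ?circle_neq0// expr1n mul1r.
  rewrite !normCK rmorphB rmorphD !rmorphM/= conjCK rmorphXn/= (circle_conj w1).
  have h2 : (2^-1 : C)^* = 2^-1 by rewrite fmorphV/= conjC_nat.
  rewrite h2 hEc.
  have wn : w ^+ n * w^-1 ^+ n = 1.
    by rewrite -exprMn divff ?circle_neq0// expr1n.
  set a := A.[w]; set e := E.[w].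
  set X := w ^+ n in wn *; set Y := w^-1 ^+ n in wn *.
  (* On the circle conj E = Y E and A~ = X conj A with X Y = 1; the mixed terms
     carry the factor 1 - X Y. *)
  transitivity (4 * ((a * a^* * (v1 * v1^* + X * Y * v2 * v2^*)) +
     Y * e * e * (v1 * v1^* + v2 * v2^*) / 4 +
     a^* * e / 2 * v1^* * v2 * (1 - X * Y))).
    by field.
  by rewrite wn; field.
pose k := (g1.[z])^*; pose l := (g2.[z])^*.
(* Squares avoid the square root of G U, and they give G^2 <= G U |D(z)|^2. *)
have := @ratio_max_principle R ((k *: g1 + l *: g2) ^+ 2) (D ^+ 2) (G * U) z.
have Dsq w : closed_disc w -> (D ^+ 2).[w] != 0.
  by move=> /D0 Dw; rewrite horner_exp expf_neq0.
have cs w : circle w ->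
    `|((k *: g1 + l *: g2) ^+ 2).[w]| <= G * U * `|(D ^+ 2).[w]|.
  move=> w1; rewrite !horner_exp !normrX hornerD !hornerZ -mulrA.
  rewrite [U * _]mulrC -isom//.
  have -> : G = `|l^*| ^+ 2 + `|k| ^+ 2 by rewrite /k /l !norm_conjC addrC.
  by rewrite -norm_rotate conjCK lerDr exprn_ge0.
move=> /(_ Dsq cs z1); rewrite !horner_exp !normrX hornerD !hornerZ.
have -> : k * g1.[z] + l * g2.[z] = G.
  by rewrite /G !normCK /k /l; ring.
rewrite ger0_norm// expr2 -mulrA.
have [->|G1] := eqVneq G 0; first by rewrite mulr_ge0// exprn_ge0.
by rewrite ler_pM2l ?lt_def ?G1// mulrC.
Qed.

(** The determinant of the matrix function is E^2 / (4 D^2) + A A~ / D^2, and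
[royal_identity] reduces it to D~ / D. *)
Lemma disc_in_closure n D A E z zeta : unit_row_data n D A E ->
  open_disc z -> `|zeta| <= 1 ->
  closure (@pentablock R)
    (zeta * (A.[z] / D.[z]), E.[z] / D.[z], (conj_rev n D).[z] / D.[z]).
Proof.
move=> dat z1 zeta1; have [sD sA D0 hE hDA] := dat.
have Dz := D0 _ (open_closed z1).
have -> : E.[z] / D.[z] = 2 * (E.[z] / 2 / D.[z]) by field.
have -> : (conj_rev n D).[z] / D.[z] =
    (E.[z] / 2 / D.[z]) ^+ 2 - A.[z] / D.[z] * (- (conj_rev n A).[z] / D.[z]).
  have /(congr1 (horner^~ z)) := royal_identity dat.
  rewrite horner_royal hornerZ hornerM => e.
  apply: (mulfI (_ : 4 * D.[z] ^+ 2 != 0)).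
    by rewrite mulf_neq0 ?expf_neq0 ?pnatr_eq0.
  transitivity (4 * (D.[z] * (conj_rev n D).[z])); first by field.
  by rewrite -[LHS](subrK (E.[z] ^+ 2)) -e; field.
apply: contraction_shrink_corner => // v1 v2.
have Dp : 0 < `|D.[z]| ^+ 2 by rewrite exprn_gt0 ?normr_gt0.
rewrite -(ler_pM2l Dp); apply: le_trans (matrix_contraction v1 v2 dat z1).
rewrite mulrDr -!exprMn -!normrM le_eqVlt; apply/orP; left; apply/eqP.
by congr (_ + _); congr (_ ^+ _); congr Num.norm; field.
Qed.

Lemma circle_in_dist_bdry n D A E z zeta : unit_row_data n D A E ->
  circle z -> `|zeta| = 1 ->
  dist_bdry_pentablock
    (zeta * (A.[z] / D.[z]), E.[z] / D.[z], (conj_rev n D).[z] / D.[z]).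
Proof.
case=> sD sA D0 hE hDA z1 zeta1; have Dz := D0 _ (circle_closed z1).
have Dp : 0 < `|D.[z]| by rewrite normr_gt0.
have Dp2 : 0 < `|D.[z]| ^+ 2 by rewrite exprn_gt0.
have e := hDA _ z1.
split.
- rewrite normf_div ler_pdivrMr// -(@ler_pXn2r _ 2) ?nnegrE ?mulr_ge0//.
  rewrite exprMn -natrX (_ : (2 ^ 2)%N = 4)// -e lerDr.
  by rewrite mulr_ge0// exprn_ge0.
- rewrite normf_div conj_rev_circle// normrM normrX z1 expr1n mul1r norm_conjC.
  by rewrite divff// gt_eqF.
- rewrite conj_rev_circle// fmorph_div/= {1}(hE _ z1).
  by field; rewrite conjC_eq0 Dz.
- rewrite normrM zeta1 mul1r -[LHS]sqrCK ?normr_ge0//; congr sqrtC.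
  rewrite !normf_div !expr_div_n; apply: (mulfI (_ : 4 * `|D.[z]| ^+ 2 != 0)).
    by rewrite mulf_neq0 ?gt_eqF// pnatr_eq0.
  transitivity (4 * `|A.[z]| ^+ 2).
    by field; rewrite gt_eqF.
  by rewrite -(addrK (`|E.[z]| ^+ 2) (4 * _)) e; field; rewrite gt_eqF.
Qed.

End Inner.

(** * The Blaschke factor and the inner function *)

Section Blaschke.
Variable R : realType.
Local Notation C := R[i].
Implicit Types (z w c b : C) (D A E N Q : {poly C}) (bs : seq C).

Definition blaschke_num c bs : {poly C} := c%:P * \prod_(b <- bs) ('X - b%:P).
Definition blaschke_den bs : {poly C} := \prod_(b <- bs) (1 - b^* *: 'X).

Lemma blaschke_prod_mul_frac c bs N Q :
  blaschke_prod c bs * (tofrac N / tofrac Q) =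
  tofrac (blaschke_num c bs * N) / tofrac (blaschke_den bs * Q).
Proof.
rewrite /blaschke_prod /blaschke prodf_div -!rmorph_prod/= -mulrA mulf_div.
by rewrite !rmorphM/= !mulrA.
Qed.

Lemma blaschke_factor_le b z : open_disc b -> closed_disc z ->
  `|z - b| <= `|1 - b^* * z|.
Proof.
rewrite /open_disc /closed_disc/= => b1 z1.
rewrite -(@ler_pXn2r _ 2) ?nnegrE// -subr_ge0.
have -> : `|1 - b^* * z| ^+ 2 - `|z - b| ^+ 2 =
    (1 - `|b| ^+ 2) * (1 - `|z| ^+ 2).
  by rewrite !normCK !rmorphB !rmorphM/= conjCK rmorph1; ring.
by rewrite mulr_ge0// subr_ge0 exprn_ile1// ltW.
Qed.

Lemma blaschke_den_neq0 bs z : (forall b, b \in bs -> open_disc b) ->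
  closed_disc z -> (blaschke_den bs).[z] != 0.
Proof.
move=> bs1 z1; rewrite horner_prod prodf_seq_neq0; apply/allP => b /bs1 b1 /=.
by rewrite horner_conj_factor conj_factor_neq0.
Qed.

Lemma blaschke_le1 c bs z : `|c| = 1 -> (forall b, b \in bs -> open_disc b) ->
  closed_disc z -> `|(blaschke_num c bs).[z] / (blaschke_den bs).[z]| <= 1.
Proof.
move=> c1 bs1 z1; have Q0 := blaschke_den_neq0 bs1 z1.
rewrite normf_div ler_pdivrMr ?normr_gt0// mul1r.
rewrite hornerM hornerC normrM c1 mul1r !horner_prod !normr_prod.
rewrite big_seq [leRHS]big_seq; apply: ler_prod => b bbs; rewrite normr_ge0/=.
rewrite hornerXsubC horner_conj_factor.
exact: blaschke_factor_le (bs1 _ bbs) z1.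
Qed.

Lemma blaschke_eq1 c bs z : `|c| = 1 -> (forall b, b \in bs -> open_disc b) ->
  circle z -> `|(blaschke_num c bs).[z] / (blaschke_den bs).[z]| = 1.
Proof.
move=> c1 bs1 z1; have Q0 := blaschke_den_neq0 bs1 (circle_closed z1).
rewrite normf_div; apply: (divIf (_ : `|(blaschke_den bs).[z]|^-1 != 0)).
  by rewrite invr_eq0 normr_eq0.
rewrite invrK mulfVK ?normr_eq0// mul1r.
rewrite hornerM hornerC normrM c1 mul1r !horner_prod !normr_prod.
apply: eq_bigr => b _.
by rewrite hornerXsubC horner_conj_factor norm_conj_factor.
Qed.

Lemma size_blaschke_num c bs : (size (blaschke_num c bs) <= (size bs).+1)%N.
Proof.
rewrite (@size_polyM_leq _ 0)// ?size_polyC_leq1//.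
by rewrite -[size bs]mul1n size_prod_leqM// => b; rewrite size_XsubC.
Qed.

Lemma size_blaschke_den bs : (size (blaschke_den bs) <= (size bs).+1)%N.
Proof.
by rewrite -[size bs]mul1n size_prod_leqM// => b; exact: size_conj_factor.
Qed.

Lemma blaschke_num_neq0 c bs : `|c| = 1 -> blaschke_num c bs != 0.
Proof.
move=> c1; rewrite mulf_neq0//.
  by rewrite polyC_eq0 -normr_eq0 c1 oner_eq0.
by rewrite prodf_seq_neq0; apply/allP => b _; rewrite /= polyXsubC_eq0.
Qed.

Lemma mup_blaschke_num c bs z : `|c| = 1 ->
  mup z (blaschke_num c bs) = count_mem z bs.
Proof.
move=> c1; rewrite mupMr; last by rewrite rootC -normr_eq0 c1 oner_eq0.
rewrite -[in RHS](map_id bs); apply: mup_prod_count => b _.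
by rewrite polyXsubC_eq0 mup_XsubC.
Qed.

Lemma inner_of_unit_row n D A E c bs : unit_row_data n D A E ->
  `|c| = 1 -> (forall b, b \in bs -> open_disc b) ->
  rational_pentablock_inner (blaschke_prod c bs * (tofrac A / tofrac D),
    tofrac E / tofrac D, tofrac (conj_rev n D) / tofrac D).
Proof.
move=> dat c1 bs1; rewrite blaschke_prod_mul_frac.
have [sD sA D0 hE hDA] := dat.
have Q0 z : closed_disc z -> (blaschke_den bs * D).[z] != 0.
  by move=> z1; rewrite hornerM mulf_neq0 ?D0// blaschke_den_neq0.
have evalE z : closed_disc z -> ratmap_eval
    (tofrac (blaschke_num c bs * A) / tofrac (blaschke_den bs * D),
     tofrac E / tofrac D, tofrac (conj_rev n D) / tofrac D) z =
    ((blaschke_num c bs).[z] / (blaschke_den bs).[z] * (A.[z] / D.[z]),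
     E.[z] / D.[z], (conj_rev n D).[z] / D.[z]).
  by move=> z1; rewrite /ratmap_eval !rat_evalE ?D0 ?Q0// !hornerM mulf_div.
split.
- by split=> z /open_closed z1; apply: derivable_rat_eval; rewrite ?D0 ?Q0.
- apply: continuous_in_subspaceT => z; rewrite inE => z1.
  apply: continuous_triple; apply/continuous_derivable/derivable_rat_eval;
    by rewrite ?D0 ?Q0.
- move=> z z1; have z1' := open_closed z1; rewrite evalE//.
  by apply: disc_in_closure => //; exact: blaschke_le1.
- move=> z z1; have z1' := circle_closed z1; rewrite evalE//.
  by apply: circle_in_dist_bdry => //; exact: blaschke_eq1.
Qed.

End Blaschke.

(** * The construction *)

Section Construction.
Variable R : realType.
Local Notation C := R[i].

Definition spectral_data n (RR E D A : {poly C}) : Prop :=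
  [/\ (size D <= n.+1)%N, (size A <= n.+1)%N, outer D, outer A
        & forall z, circle z ->
            z ^- n * RR.[z] + `|E.[z]| ^+ 2 = 4 * `|D.[z]| ^+ 2
            /\ z ^- n * RR.[z] = 4 * `|A.[z]| ^+ 2].

Variables (n : nat) (alpha beta sigma : seq C) (theta : seq R).
Variables (tp t : R) (c : C).
Let RR := Rpoly tp sigma.
Let E := Epoly t alpha theta.
Hypothesis size_sigma : size sigma = n.
Hypothesis hn : (2 * size alpha + size theta)%N = n.
Hypothesis halpha : forall w, w \in alpha -> open_disc w.
Hypothesis hbeta : forall w, w \in beta -> open_disc w.
Hypothesis hsigma : forall w, w \in sigma -> closed_disc w.
Hypothesis hsigma_eta : forall w, w \in sigma -> w \notin map (@cis R) theta.
Hypothesis tp0 : 0 < tp.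
Hypothesis t0 : t != 0.
Hypothesis c1 : `|c| = 1.

Lemma E_self_reciprocal : self_reciprocal n E.
Proof. by rewrite -hn; exact: self_reciprocal_Epoly. Qed.

Lemma size_E : (size E <= n.+1)%N.
Proof. by rewrite -hn; exact: size_Epoly. Qed.

(** A zero on the circle of both nonnegative terms is one of the sigma_j and one
of the eta_j. *)
Lemma spectral_density_gt0 z : circle z -> 0 < z ^- n * RR.[z] + `|E.[z]| ^+ 2.
Proof.
move=> z1; rewrite -size_sigma circle_Rpoly//.
have R0 : 0 <= tp%:C%C * \prod_(w <- sigma) `|z - w| ^+ 2.
  apply: mulr_ge0; first by rewrite ler0c ltW.
  by apply: prodr_ge0 => w _; rewrite exprn_ge0.
rewrite lt_def addr_ge0 ?exprn_ge0// andbT paddr_eq0 ?exprn_ge0//.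
rewrite -circle_Rpoly// mulf_eq0 invr_eq0 !expf_eq0/=.
rewrite (negbTE (circle_neq0 z1)) andbF orFb normr_eq0.
rewrite root_Rpoly//; last exact: circle_closed.
apply/negP => /andP[zs Ez].
have : (0 < mup z E)%N.
  by rewrite -XsubC_dvd ?Epoly_neq0// dvdp_XsubCl.
rewrite mup_Epoly//; last exact: circle_closed.
rewrite -has_count has_pred1 mem_cat (negbTE (hsigma_eta zs)) orbF => /halpha.
by rewrite /open_disc/= z1 ltxx.
Qed.

(** On the circle E^2 = z^n |E|^2, so R + E^2 is the polynomial to which
[fejer_riesz] applies.  For A a spectral factor is explicit, since
|1 - conj w z| = |z - w| there, and it is outer as |sigma_j| <= 1. *)
Lemma spectral_exists : exists D A, spectral_data n RR E D A.
Proof.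
have [|z z1|D [sD D0 hD]] := @fejer_riesz R n (4^-1 *: (RR + E ^+ 2)).
- rewrite (leq_trans (size_scale_leq _ _))// (leq_trans (size_polyD _ _))//.
  rewrite geq_max -{1}size_sigma size_Rpoly/= expr2 -addnn.
  by rewrite size_polyM_leq ?size_E.
- rewrite hornerZ hornerD horner_exp (self_reciprocal_sqr E_self_reciprocal z1).
  rewrite mulrCA mulrDr mulrA mulVf ?expf_neq0 ?circle_neq0// mul1r.
  by rewrite mulr_gt0 ?invr_gt0 ?ltr0n// spectral_density_gt0.
exists D, ((sqrtC tp%:C%C / 2) *: blaschke_den sigma); split=> //.
- by rewrite (leq_trans (size_scale_leq _ _))// -size_sigma size_blaschke_den.
- by move=> z /open_closed/D0.
- move=> z z1; rewrite hornerZ mulf_neq0//.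
    by rewrite mulf_neq0 ?invr_eq0 ?pnatr_eq0// sqrtC_eq0 gt_eqF// (ltcR 0).
  rewrite horner_prod prodf_seq_neq0; apply/allP => w ws /=.
  rewrite horner_conj_factor.
  have -> : 1 - w^* * z = (1 - z^* * w)^*.
    by rewrite rmorphB rmorphM/= conjCK rmorph1 mulrC.
  by rewrite conjC_eq0; exact: conj_factor_neq0 z1 (hsigma ws).
- move=> z z1; have := hD _ z1.
  rewrite hornerZ hornerD horner_exp (self_reciprocal_sqr E_self_reciprocal z1).
  rewrite mulrCA mulrDr mulrA mulVf ?expf_neq0 ?circle_neq0// mul1r => <-.
  split; first by rewrite mulVKf// pnatr_eq0.
  rewrite -size_sigma circle_Rpoly// hornerZ !normrM !exprMn.
  have -> : `|sqrtC tp%:C%C| ^+ 2 = tp%:C%C :> C.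
    by rewrite -normrX sqrtCK gtr0_norm// (ltcR 0).
  have -> : `|(blaschke_den sigma).[z]| = \prod_(w <- sigma) `|z - w|.
    rewrite horner_prod normr_prod; apply: eq_bigr => w _.
    by rewrite horner_conj_factor norm_conj_factor.
  rewrite -prodrXl normfV normr_nat mulrCA !mulrA.
  by congr (_ * _); field.
Qed.

Section SpectralPair.
Variables D A : {poly C}.
Hypothesis hDA : spectral_data n RR E D A.

(** An outer D may have zeros on the circle; the positivity of 4 |D|^2 excludes
them. *)
Lemma D_neq0 z : closed_disc z -> D.[z] != 0.
Proof.
have [sD sA oD oA h] := hDA.
case/closed_disc_cases => [/oD//|z1].
have := spectral_density_gt0 z1; rewrite (h _ z1).1; apply: contraTneq => ->.
by rewrite normr0 expr0n mulr0 ltxx.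
Qed.

Lemma spectral_unit_row : unit_row_data n D A E.
Proof.
have [sD sA oD oA h] := hDA; split=> //.
- exact: D_neq0.
- exact: E_self_reciprocal.
- by move=> z z1; have [<- <-] := h _ z1.
Qed.

Lemma RR_royal : RR = royal_poly n D E.
Proof.
have [sD sA oD oA h] := hDA; apply: poly_circle_eq => z z1.
rewrite horner_royal mul_conj_rev//.
rewrite (self_reciprocal_sqr E_self_reciprocal z1) mulrCA -mulrBr.
by rewrite -(h _ z1).1 addrK mulVKf// expf_neq0// circle_neq0.
Qed.

Let a := blaschke_prod c beta * (tofrac A / tofrac D).
Let s : ratfun R := tofrac E / tofrac D.
Let p : ratfun R := tofrac (conj_rev n D) / tofrac D.

Lemma D_poly_neq0 : D != 0.
Proof.
have := @D_neq0 0; rewrite /closed_disc/= normr0 ler01 => /(_ isT).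
by apply: contraNneq => ->; rewrite horner0.
Qed.

Lemma A_neq0 : A != 0.
Proof.
have [_ _ _ oA _] := hDA; have := oA 0; rewrite /open_disc/= normr0 ltr01.
by move=> /(_ isT); apply: contraNneq => ->; rewrite horner0.
Qed.

Lemma construction :
  [/\ rational_pentablock_inner (a, s, p),
      pdeg_le (a, s, p) (size beta + n) n,
      zeros_are (@open_disc R) a beta,
      zeros_are (@closed_disc R) s (alpha ++ map (@cis R) theta)
    & royal_nodes s p = [set z | z \in sigma]]
  /\ (forall z, closed_disc z -> D.[z] != 0)
  /\ RR = royal_poly n D E.
Proof.
have [sD sA oD oA h] := hDA.
have den0 : blaschke_den beta != 0.
  by rewrite prodf_seq_neq0; apply/allP => b _; exact: conj_factor_polyneq0.
have D0 := D_poly_neq0.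
split; last by split; [exact: D_neq0|exact: RR_royal].
split.
- exact: inner_of_unit_row spectral_unit_row c1 hbeta.
- split; last by apply: rat_deg_le => //; exact: size_poly.
  rewrite /a blaschke_prod_mul_frac; apply: rat_deg_le.
  + by rewrite mulf_neq0.
  + by rewrite size_polyM_leq// size_blaschke_num.
  + by rewrite size_polyM_leq// size_blaschke_den.
- rewrite /a blaschke_prod_mul_frac; apply: zeros_are_frac.
  + by rewrite mulf_neq0 ?A_neq0// blaschke_num_neq0.
  + move=> z /open_closed z1.
    by rewrite hornerM mulf_neq0 ?D_neq0// blaschke_den_neq0.
  + by exists 0; rewrite /open_disc/= normr0.
  + move=> z; case: ifPn; rewrite ?inE ?notin_setE => z1.
      by rewrite mupMl ?mup_blaschke_num// /root oA.
    apply/eqP; rewrite -leqn0 leqNgt -has_count has_pred1.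
    by apply/negP => /hbeta.
- apply: zeros_are_frac.
  + exact: Epoly_neq0.
  + exact: D_neq0.
  + by exists 0; rewrite /closed_disc/= normr0.
  + move=> z; case: ifPn; rewrite ?inE ?notin_setE => z1.
      by rewrite mup_Epoly.
    apply/eqP; rewrite -leqn0 leqNgt -has_count has_pred1; apply/negP.
    rewrite mem_cat => /orP[/halpha/open_closed//|/mapP[th _ zth]].
    by apply: z1; rewrite /closed_disc/= zth normr_cis.
- apply/seteqP; split=> [z [z1]|z /= zs].
    rewrite /= !rat_evalE ?D_neq0// -(root_Rpoly tp0 hsigma z1) => e.
    have Dz := D_neq0 z1; apply/eqP.
    rewrite -/RR RR_royal horner_royal.
    have -> : E.[z] ^+ 2 = (E.[z] / D.[z]) ^+ 2 * D.[z] ^+ 2 by field.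
    by rewrite e; field.
  have z1 := hsigma zs; split=> //; have Dz := D_neq0 z1.
  move: (zs); rewrite -(root_Rpoly tp0 hsigma z1) -/RR RR_royal.
  rewrite horner_royal subr_eq0.
  rewrite !rat_evalE// expr_div_n => /eqP <-.
  by field.
Qed.

End SpectralPair.
End Construction.

Theorem theorem8p6 (R : realType) (n m k0 k1 : nat)
    (alpha : k0.-tuple R[i]) (eta : k1.-tuple R[i])
    (beta : m.-tuple R[i]) (sigma : n.-tuple R[i])
    (hn : (2 * k0 + k1)%N = n)
    (halpha : forall j, open_disc (tnth alpha j))
    (heta : forall j, circle (tnth eta j))
    (hbeta : forall j, open_disc (tnth beta j))
    (hsigma : forall j, closed_disc (tnth sigma j))
    (hsigma_eta : forall j l, tnth sigma j != tnth eta l) :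
  (exists a s p : ratfun R,
    [/\ rational_pentablock_inner (a, s, p),
        pdeg_le (a, s, p) (m + n) n,
        zeros_are (@open_disc R) a beta,
        zeros_are (@closed_disc R) s (alpha ++ eta)
      & royal_nodes s p = [set z | z \in (sigma : seq R[i])]])
  /\
  (forall (tp t : R) (c : R[i]) (theta : k1.-tuple R),
    0 < tp -> t != 0 -> `|c| = 1 ->
    (forall j, 0 <= tnth theta j < 2 * pi
               /\ tnth eta j = cis (tnth theta j)) ->
    let RR := Rpoly tp sigma in
    let E := Epoly t alpha theta in
    let spectral (D A : {poly R[i]}) :=
      [/\ (size D <= n.+1)%N, (size A <= n.+1)%N, outer D, outer A
        & forall z, circle z ->
            z ^- n * RR.[z] + `|E.[z]| ^+ 2 = 4 * `|D.[z]| ^+ 2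
            /\ z ^- n * RR.[z] = 4 * `|A.[z]| ^+ 2] in
    (exists D A : {poly R[i]}, spectral D A)
    /\
    (forall D A : {poly R[i]}, spectral D A ->
      let a := blaschke_prod c beta * (tofrac A / tofrac D) in
      let s := tofrac E / tofrac D in
      let p := tofrac (conj_rev n D) / tofrac D in
      [/\ rational_pentablock_inner (a, s, p),
          pdeg_le (a, s, p) (m + n) n,
          zeros_are (@open_disc R) a beta,
          zeros_are (@closed_disc R) s (alpha ++ eta)
        & royal_nodes s p = [set z | z \in (sigma : seq R[i])]]
      /\ (forall z, closed_disc z -> D.[z] != 0)
      /\ RR = royal_poly n D E)).
Proof.
have alpha1 w : w \in (alpha : seq _) -> open_disc w by case/tnthP=> j ->.
have beta1 w : w \in (beta : seq _) -> open_disc w by case/tnthP=> j ->.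
have sigma1 w : w \in (sigma : seq _) -> closed_disc w by case/tnthP=> j ->.
have etaE (theta : k1.-tuple R) :
    (forall j, tnth eta j = cis (tnth theta j)) ->
    (eta : seq _) = map (@cis R) theta.
  move=> th; suff -> : eta = map_tuple (@cis R) theta by [].
  by apply: eq_from_tnth => j; rewrite tnth_map.
have sigma_eta w : w \in (sigma : seq _) -> w \notin (eta : seq _).
  move=> /tnthP[j ->]; apply/negP => /tnthP[l]; exact/eqP/hsigma_eta.
have built (tp t : R) (c : R[i]) (theta : k1.-tuple R) :
    0 < tp -> t != 0 -> `|c| = 1 ->
    (forall j, 0 <= tnth theta j < 2 * pi
               /\ tnth eta j = cis (tnth theta j)) ->
    (exists D A, spectral_data n (Rpoly tp sigma) (Epoly t alpha theta) D A) /\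
    forall D A, spectral_data n (Rpoly tp sigma) (Epoly t alpha theta) D A ->
      let a := blaschke_prod c beta * (tofrac A / tofrac D) in
      let s := tofrac (Epoly t alpha theta) / tofrac D in
      let p := tofrac (conj_rev n D) / tofrac D in
      [/\ rational_pentablock_inner (a, s, p), pdeg_le (a, s, p) (m + n) n,
          zeros_are (@open_disc R) a beta,
          zeros_are (@closed_disc R) s (alpha ++ eta)
        & royal_nodes s p = [set z | z \in (sigma : seq R[i])]]
      /\ (forall z, closed_disc z -> D.[z] != 0)
      /\ Rpoly tp sigma = royal_poly n D (Epoly t alpha theta).
  move=> tp0 t0 c1 th; have eE := etaE theta (fun j => (th j).2).
  have se w : w \in (sigma : seq _) -> w \notin map (@cis R) theta.
    by rewrite -eE; exact: sigma_eta.
  have sz : (2 * size alpha + size theta)%N = n by rewrite !size_tuple.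
  have sn := size_tuple sigma.
  split; first exact: spectral_exists sn sz alpha1 sigma1 se tp0 t0.
  move=> D A hDA a s p; rewrite eE -[in X in pdeg_le _ X _](size_tuple beta).
  exact: construction sn sz alpha1 beta1 sigma1 se tp0 t0 c1 _ _ hDA.
split; last by move=> tp t c theta tp0 t0 c1 th; exact: built tp0 t0 c1 th.
have /choice[th thP] : forall j, exists th : R,
    0 <= th < 2 * pi /\ tnth eta j = cis th.
  by move=> j; apply/cis_surj/heta.
have thT j : 0 <= tnth (mktuple th) j < 2 * pi
    /\ tnth eta j = cis (tnth (mktuple th) j).
  by rewrite tnth_mktuple.
have [[D [A hDA]]] :=
  built 1 1 1 (mktuple th) ltr01 (oner_neq0 _) (normr1 _) thT.
by move=> /(_ D A hDA)[H _]; eexists; eexists; eexists; exact: H.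
Qed.
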